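(* Let $K_1$ be a small sphere of spherical radius $\pi/4$ in $S^n\subset\mathbb{R}^{n+1}$, and let $K_2=-K_1$ be its image under the antipodal map. Then the resulting timelike spherical Hilbert geometry, associated with the pair $K_1,K_2$, is isometric to the de Sitter metric restricted to the timelike vectors; under this isometry the de Sitter distance is equal to the timelike spherical Hilbert distance.
   Context: De Sitter space: $\mathrm{dS}^{n-1,1}=\{(x_0,\dots,x_n)\in\mathbb{R}^{n+1}: -x_0^2+\sum_{i=1}^n x_i^2=1\}$, with the Lorentzian metric induced by $-dx_0^2+\sum_{i=1}^n dx_i^2$, time-oriented so that $x_0$ increases towards the future. A point $q$ lies in the future of $p$ if there is a piecewise $C^1$ (future-directed) timelike curve, i.e. a curve whose tangent vectors have negative square, from $p$ to $q$; the de Sitter distance from $p$ to such a $q$ is the length $\int\sqrt{-\langle\sigma',\sigma'\rangle}\,dt$ of the timelike geodesic $\sigma$ from $p$ to $q$. Timelike spherical Hilbert geometry: $S^n$ is the unit sphere with its standard distance $d$; $I_1$ is the open spherical ball of radius $\pi/4$ bounded by $K_1$, $I_2=-I_1$, $\overline{K_i}=K_i\cup I_i$, and $\Omega=S^n\setminus(\overline{K_1}\cup\overline{K_2})$. A supporting hyperplane of $K_i$ is a great hypersphere meeting $K_i$ and having $I_i$ in one component of its complement. For distinct $p,q\in\Omega$, $p<q$ means there is a great circle arc $]a_1,a_2[\subset\Omega$ with $a_1\in K_1$, $a_2\in K_2$, not contained in any supporting hyperplane of $K_1$ or $K_2$, containing $p,q$, with $a_1,p,q,a_2$ in that order; the timelike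 spherical Hilbert distance is then \[ H(p,q)=\frac12\log\frac{\sin d(p,a_2)\,\sin d(q,a_1)}{\sin d(q,a_2)\,\sin d(p,a_1)}, \] and $H(p,p)=0$. *)

(* Defs.v *)
From HB Require Import structures.
From mathcomp Require Import all_boot all_order all_algebra.
From mathcomp Require Import all_classical all_reals all_analysis.

Set Implicit Arguments.
Unset Strict Implicit.
Unset Printing Implicit Defensive.

Import Order.TTheory GRing.Theory Num.Theory.
Import numFieldNormedType.Exports.

Local Open Scope classical_set_scope.
Local Open Scope ring_scope.

(* Points of R^(n+1) are row vectors 'rV[R]_n.+1; the coordinate x_i is x 0 i,
   and x_0, the time coordinate, is x 0 ord0.  Continuity and derivatives refer
   to the normed-module structure of 'rV[R]_n.+1 (max norm); lengths and angles
   only to the bilinear forms [lorentz] and [edot]. *)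

Section DeSitter.
Variables (R : realType) (n : nat).
Implicit Types (x y p q : 'rV[R]_n.+1) (sigma v w : R -> 'rV[R]_n.+1).

Definition lorentz x y : R :=
  - (x 0 ord0 * y 0 ord0) + \sum_(i < n) x 0 (lift ord0 i) * y 0 (lift ord0 i).

Definition deSitter : set 'rV[R]_n.+1 := [set x | lorentz x x = 1].

(* [sigma] is C^1 on the closed interval [a, b] and [v] is its velocity there;
   at a and b, [v] is the one-sided derivative, because it is the limit of the
   derivatives at interior points. *)
Definition C1_on (a b : R) sigma v : Prop :=
  [/\ {within `[a, b], continuous sigma}, {within `[a, b], continuous v}
    & forall t, t \in `]a, b[ -> is_derive t 1 sigma (v t)].

Definition future_timelike x : Prop := lorentz x x < 0 /\ 0 < x 0 ord0.

(* [sigma] is defined on [s 0, s k] and is C^1 on each [s i, s i.+1], so at an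
   interior subdivision point both one-sided velocities are future timelike. *)
Definition piecewise_timelike_curve (k : nat) (s : nat -> R) sigma : Prop :=
  [/\ (0 < k)%N,
      forall i, (i < k)%N -> s i < s i.+1,
      forall t, t \in `[s 0%N, s k] -> deSitter (sigma t)
    & forall i, (i < k)%N -> exists2 v, C1_on (s i) (s i.+1) sigma v
        & forall t, t \in `[s i, s i.+1] -> future_timelike (v t)].

Definition in_future p q : Prop :=
  exists k s sigma,
    [/\ piecewise_timelike_curve k s sigma, sigma (s 0%N) = p & sigma (s k) = q].

(* The Levi-Civita connection of the induced metric is the tangential part of
   the flat derivative, and the tangent space of [deSitter] at x is the
   [lorentz]-orthogonal of x: a geodesic is a curve whose acceleration is
   [lorentz]-orthogonal to the tangent space. *)
Definition timelike_geodesic (a b : R) sigma v : Prop :=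
  [/\ a < b,
      forall t, t \in `[a, b] -> deSitter (sigma t),
      C1_on a b sigma v,
      forall t, t \in `[a, b] -> future_timelike (v t)
    & exists2 w, C1_on a b v w
        & forall t, t \in `[a, b] ->
            forall x, lorentz (sigma t) x = 0 -> lorentz (w t) x = 0].

Definition lorentz_length (a b : R) v : R :=
  Rintegral lebesgue_measure `[a, b]%classic
    (fun t => Num.sqrt (- lorentz (v t) (v t))).

(* The set of all values of the distance from p to q: the lengths of the
   timelike geodesics from p to q, and 0 when p = q.  The distance is defined,
   and equal to d, exactly when this set is [set d]. *)
Definition deSitter_dist p q : set R :=
  [set d | (p = q /\ d = 0) \/
    exists a b sigma v, [/\ timelike_geodesic a b sigma v,
      sigma a = p, sigma b = q & d = lorentz_length a b v]].

End DeSitter.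

Section TimelikeSphericalHilbert.
Variables (R : realType) (n : nat).
Implicit Types (x y p q a u v c : 'rV[R]_n.+1) (H K I : set 'rV[R]_n.+1).

Definition edot x y : R := \sum_(i < n.+1) x 0 i * y 0 i.

Definition usphere : set 'rV[R]_n.+1 := [set x | edot x x = 1].

Definition sdist x y : R := acos (edot x y).

Definition small_sphere c (r : R) : set 'rV[R]_n.+1 :=
  [set x | usphere x /\ sdist c x = r].

Definition open_sball c (r : R) : set 'rV[R]_n.+1 :=
  [set x | usphere x /\ sdist c x < r].

Definition great_hypersphere u : set 'rV[R]_n.+1 :=
  [set x | usphere x /\ edot u x = 0].

Definition supporting_hyperplane K I H : Prop :=
  [/\ exists2 u, u != 0 & H = great_hypersphere u,
      H `&` K !=set0
    & exists2 x, (usphere `\` H) x &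
        I `<=` connected_component (usphere `\` H) x].

(* A pair of hypersurfaces together with the open sets they bound. *)
Record sphere_pair := SpherePair {
  K1 : set 'rV[R]_n.+1; I1 : set 'rV[R]_n.+1;
  K2 : set 'rV[R]_n.+1; I2 : set 'rV[R]_n.+1 }.

Definition antipodal_pair c (r : R) : sphere_pair :=
  {| K1 := small_sphere c r; I1 := open_sball c r;
     K2 := [set - x | x in small_sphere c r];
     I2 := [set - x | x in open_sball c r] |}.

Variable P : sphere_pair.

Definition hilbert_domain : set 'rV[R]_n.+1 :=
  usphere `\` ((K1 P `|` I1 P) `|` (K2 P `|` I2 P)).

(* Arc-length parametrization of the great circle through the unit vector [a]
   with unit tangent vector [v] at [a]. *)
Definition great_circle a v (t : R) : 'rV[R]_n.+1 := cos t *: a + sin t *: v.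

(* There is an arc ]a1, a2[ in the domain, from K1 to K2 and not contained in
   a supporting hyperplane, containing distinct points p and q such that a1, p,
   q, a2 occur in that order; L is the length of the arc. *)
Definition hilbert_chord p q a1 a2 : Prop :=
  exists v (L s t : R),
    let arc := [set great_circle a1 v z | z in `]0, L[] in
    [/\ [/\ K1 P a1, K2 P a2, usphere v, edot a1 v = 0
          & a2 = great_circle a1 v L],
        arc `<=` hilbert_domain,
        forall H, supporting_hyperplane (K1 P) (I1 P) H \/
          supporting_hyperplane (K2 P) (I2 P) H -> ~ (arc `<=` H),
        p = great_circle a1 v s /\ q = great_circle a1 v t
      & [/\ 0 < s, s < t, t < L & L < 2 * pi]].

Definition hilbert_lt p q : Prop := exists a1 a2, hilbert_chord p q a1 a2.

(* The set of all values of H(p, q), read as for [deSitter_dist]. *)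
Definition hilbert_dist p q : set R :=
  [set d | (p = q /\ d = 0) \/
    exists a1 a2, hilbert_chord p q a1 a2 /\
      d = 2^-1 * ln ((sin (sdist p a2) * sin (sdist q a1)) /
                     (sin (sdist q a2) * sin (sdist p a1)))].

End TimelikeSphericalHilbert.

Section Homeomorphism.
Variables (T U : topologicalType).

Definition homeomorphism_on (A : set T) (B : set U) (f : T -> U) : Prop :=
  set_bij A B f /\ {within A, continuous f} /\
  exists2 g : U -> T, {within B, continuous g} & {in A, cancel f g}.

End Homeomorphism.

(* Main.v *)
(* De Sitter space is the set of unit spacelike vectors of the Lorentz form, and
   the domain is the set of spacelike vectors of Euclidean norm 1, once the
   time axis is rotated to [c]; the isometry is the radial projection.  It maps
   the timelike geodesic from p to q to the arc of the plane they span, whose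
   ends are the two null directions of that plane.  In a basis of null vectors
   a1, a2 of the plane, p = s1 a1 + t1 a2 and q = s2 a1 + t2 a2, the ratio of
   sines in the Hilbert distance is r = s1 t2 / (s2 t1), and normalizing p and q
   gives <p, q> = (r^(1/2) + r^(-1/2)) / 2: the Hilbert distance d satisfies
   cosh d = <p, q>.  On the other side, along a geodesic sigma of speed K
   issuing from p, the function <p, sigma t> solves g'' = K^2 g, so the length
   satisfies the same equation.  Both order relations amount to <p, q> > 1
   together with q - p pointing to the future. *)

Require Import Defs.
From mathcomp Require Import all_boot all_order all_algebra.
From mathcomp Require Import all_classical all_reals all_analysis.
From mathcomp Require Import ring lra.

Set Implicit Arguments.
Unset Strict Implicit.
Unset Printing Implicit Defensive.

Import Order.TTheory GRing.Theory Num.Theory.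
Import numFieldNormedType.Exports.

Local Open Scope classical_set_scope.
Local Open Scope ring_scope.

(** * Bilinearity and Cauchy-Schwarz for the Euclidean product *)

Section EuclideanForm.
Variables (R : realType) (n : nat).
Implicit Types (x y z : 'rV[R]_n.+1) (k : R).

Lemma edotC x y : edot x y = edot y x.
Proof. by apply: eq_bigr => i _; rewrite mulrC. Qed.

Lemma edotDl x y z : edot (x + y) z = edot x z + edot y z.
Proof. by rewrite /edot -big_split; apply: eq_bigr => i _; rewrite mxE mulrDl. Qed.

Lemma edotZl k x z : edot (k *: x) z = k * edot x z.
Proof. by rewrite /edot mulr_sumr; apply: eq_bigr => i _; rewrite mxE mulrA. Qed.

Lemma edotNl x z : edot (- x) z = - edot x z.
Proof. by rewrite -scaleN1r edotZl mulN1r. Qed.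

Lemma edotDr x y z : edot z (x + y) = edot z x + edot z y.
Proof. by rewrite edotC edotDl !(edotC z). Qed.

Lemma edotZr k x z : edot z (k *: x) = k * edot z x.
Proof. by rewrite edotC edotZl edotC. Qed.

Lemma edotNr x z : edot z (- x) = - edot z x.
Proof. by rewrite edotC edotNl edotC. Qed.

Definition edotE := (edotDl, edotDr, edotZl, edotZr, edotNl, edotNr).

Lemma edot_ge0 x : 0 <= edot x x.
Proof. by apply: sumr_ge0 => i _; rewrite -expr2 sqr_ge0. Qed.

Lemma edot_eq0 x : edot x x = 0 -> x = 0.
Proof.
move=> /eqP; rewrite psumr_eq0; last by move=> i _; rewrite -expr2 sqr_ge0.
move=> /allP x0; apply/rowP => i; rewrite mxE.
by have := x0 i (mem_index_enum _); rewrite -expr2 sqrf_eq0 => /eqP.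
Qed.

Lemma edot_cauchy x y : edot x y ^+ 2 <= edot x x * edot y y.
Proof.
have [y0|y0] := eqVneq (edot y y) 0.
  by rewrite (edot_eq0 y0) -(scale0r y) !edotE !mul0r mulr0 expr0n.
have yy : 0 < edot y y by rewrite lt_def y0 edot_ge0.
have := edot_ge0 (edot y y *: x - edot x y *: y).
rewrite !edotE (edotC y x) => h.
rewrite -(ler_pM2l yy); nra.
Qed.

End EuclideanForm.

(** * Lorentz forms with an arbitrary time axis; normalization *)

Section LorentzForm.
Variables (R : realType) (n : nat).
Implicit Types (c x y z p q : 'rV[R]_n.+1) (k : R).

(* The Lorentz form whose time axis is spanned by the unit vector [c]. *)
Definition cform c x y : R := edot x y - 2 * (edot c x * edot c y).

Lemma cformC c x y : cform c x y = cform c y x.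
Proof. by rewrite /cform edotC; congr (_ - _); rewrite (mulrC (edot c x)). Qed.

Lemma cformDl c x y z : cform c (x + y) z = cform c x z + cform c y z.
Proof. by rewrite /cform !edotE; ring. Qed.

Lemma cformDr c x y z : cform c z (x + y) = cform c z x + cform c z y.
Proof. by rewrite /cform !edotE; ring. Qed.

Lemma cformZl c k x z : cform c (k *: x) z = k * cform c x z.
Proof. by rewrite /cform !edotE; ring. Qed.

Lemma cformZr c k x z : cform c z (k *: x) = k * cform c z x.
Proof. by rewrite /cform !edotE; ring. Qed.

Lemma cformNl c x z : cform c (- x) z = - cform c x z.
Proof. by rewrite /cform !edotE; ring. Qed.

Lemma cformNr c x z : cform c z (- x) = - cform c z x.
Proof. by rewrite /cform !edotE; ring. Qed.

Definition cformE := (cformDl, cformDr, cformZl, cformZr, cformNl, cformNr).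

Lemma cform_edotE c x y : cform c x y = edot (x - (2 * edot c x) *: c) y.
Proof. by rewrite /cform !edotE; ring. Qed.

(** Cauchy-Schwarz applied to the spatial parts of [x] and [y], their components orthogonal to
    [c]. *)
Lemma cform_cauchy c x y : usphere c ->
  (edot x y - edot c x * edot c y) ^+ 2 <=
    (edot x x - edot c x ^+ 2) * (edot y y - edot c y ^+ 2).
Proof.
rewrite /usphere/= => c1.
have := edot_cauchy (x - edot c x *: c) (y - edot c y *: c).
rewrite !edotE (edotC y c) (edotC x c) c1 => h.
by apply: le_trans (le_trans h _); rewrite le_eqVlt; apply/orP; left; apply/eqP; ring.
Qed.

(** For causal vectors in opposite half-cones, the form is the product of the spatial parts minus
    [edot c x * edot c y]. The subtracted product is nonpositive, and by [cform_cauchy] it dominates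
    the spatial term in absolute value. *)
Lemma causal_sign c x y : usphere c -> cform c x x <= 0 -> cform c y y <= 0 ->
  0 <= edot c x -> edot c y <= 0 -> 0 <= cform c x y.
Proof.
move=> c1 xx yy x0 y0; have := cform_cauchy x y c1.
rewrite /cform in xx yy *.
set X := edot c x in xx x0 *; set Y := edot c y in yy y0 *.
set e := edot x y; set a := edot x x in xx *; set b := edot y y in yy *.
move=> h; rewrite leNgt; apply/negP => neg.
have cx := cform_cauchy x x c1; have cy := cform_cauchy y y c1.
have ax : 0 <= a - X ^+ 2.
  have := edot_ge0 (x - X *: c); rewrite !edotE (edotC x c) -/X -/a.
  by move: c1; rewrite /usphere/= => ->; lra.
have by0 : 0 <= b - Y ^+ 2.
  have := edot_ge0 (y - Y *: c); rewrite !edotE (edotC y c) -/Y -/b.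
  by move: c1; rewrite /usphere/= => ->; lra.
have h2 : (a - X ^+ 2) * (b - Y ^+ 2) <= X ^+ 2 * Y ^+ 2.
  by apply: ler_pM => //; lra.
have XY : X * Y <= 0 by rewrite mulr_ge0_le0.
nra.
Qed.

Definition normalize x : 'rV[R]_n.+1 := (Num.sqrt (edot x x))^-1 *: x.

Lemma edot_normalize x : x != 0 -> edot (normalize x) (normalize x) = 1.
Proof.
move=> x0; have xx : 0 < edot x x.
  by rewrite lt_def edot_ge0 andbT; apply: contra x0 => /eqP/edot_eq0 ->.
rewrite !edotE mulrA -invfM -expr2 sqr_sqrtr ?edot_ge0// mulVf//.
exact: lt0r_neq0.
Qed.

Lemma sqrt_edot_gt0 x : x != 0 -> 0 < Num.sqrt (edot x x).
Proof.
move=> x0; rewrite sqrtr_gt0 lt_def edot_ge0 andbT.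
by apply: contra x0 => /eqP/edot_eq0 ->.
Qed.

End LorentzForm.

(** * The hyperbolic cosine as a bijection from positive reals to reals above 1 *)

Section HyperbolicCosine.
Variable R : realType.
Implicit Types (b d t : R).

Definition cosh t : R := (expR t + expR (- t)) / 2.

Lemma cosh_gt1 d : 0 < d -> 1 < cosh d.
Proof.
move=> d0; rewrite /cosh expRN.
have e1 : 1 < expR d by rewrite expR_gt1.
have e0 : expR d != 0 by apply: lt0r_neq0; exact: expR_gt0.
have -> : (expR d + (expR d)^-1) / 2 = 1 + (expR d - 1) ^+ 2 / (2 * expR d).
  by field.
by rewrite ltrDl divr_gt0 ?exprn_gt0//; [lra|rewrite mulr_gt0// expR_gt0].
Qed.

Lemma cosh_inj d t : 0 < d -> 0 < t -> cosh d = cosh t -> d = t.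
Proof.
rewrite /cosh !expRN => d0 t0 e; apply: expR_inj.
have d1 : 1 < expR d by rewrite expR_gt1.
have t1 : 1 < expR t by rewrite expR_gt1.
move: d1 t1 e; set x := expR d; set y := expR t => d1 t1 e.
have x0 : x != 0 by apply: lt0r_neq0; lra.
have y0 : y != 0 by apply: lt0r_neq0; lra.
(* Clearing denominators factors the equation; the second factor is positive because both
   exponentials exceed 1. *)
have : (x - y) * (x * y - 1) = 0.
  have -> : (x - y) * (x * y - 1) = 2 * x * y * ((x + x^-1) / 2 - (y + y^-1) / 2).
    by field; rewrite x0 y0.
  by rewrite e subrr mulr0.
move=> /eqP; rewrite mulf_eq0 => /orP[/eqP|/eqP h]; first lra.
by nra.
Qed.

Lemma cosh0 : cosh 0 = 1.
Proof. by rewrite /cosh oppr0 expR0; lra. Qed.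

Lemma cosh_inj_ge0 d t : 0 <= d -> 0 <= t -> cosh d = cosh t -> d = t.
Proof.
rewrite !le_eqVlt => /predU1P[<-|d0] /predU1P[<-|t0] //.
- by rewrite cosh0 => e; have := cosh_gt1 t0; rewrite -e ltxx.
- by rewrite cosh0 => e; have := cosh_gt1 d0; rewrite e ltxx.
- exact: cosh_inj.
Qed.

Lemma cosh_surj b : 1 < b -> exists2 d, 0 < d & cosh d = b.
Proof.
move=> b1; have b2 : 0 < b ^+ 2 - 1 by nra.
pose s := Num.sqrt (b ^+ 2 - 1).
have s0 : 0 < s by rewrite sqrtr_gt0.
have ss : s ^+ 2 = b ^+ 2 - 1 by rewrite sqr_sqrtr// ltW.
(* The logarithmic formula for the inverse hyperbolic cosine; [b - s] is the inverse of [b + s]. *)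
exists (ln (b + s)); first by rewrite ln_gt0//; lra.
rewrite /cosh expRN lnK; last by rewrite posrE; lra.
have bs : b + s != 0 by apply: lt0r_neq0; lra.
have -> : (b + s)^-1 = b - s.
  by apply: (mulfI bs); rewrite divff//; lra.
by lra.
Qed.

End HyperbolicCosine.

(** * Angles, and the cosine of pi/4 *)

Section TrigonometricLemmas.
Variable R : realType.
Implicit Types (x y s t : R).

(** The value 1/2 is what puts the small spheres of radius pi/4 on the null cone of [cform]. *)
Lemma cos_piquarter_sqr : cos (pi / 4) ^+ 2 = 2^-1 :> R.
Proof.
have := @cos_mulr2n R (pi / 4).
have -> : (pi / 4) *+ 2 = pi / 2 :> R by rewrite -mulr_natr; field.
by rewrite cos_pihalf; lra.
Qed.

Lemma cos_piquarter_gt0 : 0 < cos (pi / 4) :> R.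
Proof. by apply: cos_gt0_pihalf; have := pi_gt0 R; lra. Qed.

Lemma acos_lt_piquarter x : -1 <= x <= 1 ->
  (acos x < pi / 4) = (cos (pi / 4) < x).
Proof.
move=> x1; have p0 := pi_gt0 R.
rewrite -{2}(acosK (x := x)) ?in_itv//= ltr_cos// in_itv/=.
  by rewrite acos_ge0// acos_lepi.
by apply/andP; split; lra.
Qed.

Lemma acos_eq_piquarter x : -1 <= x <= 1 ->
  acos x = pi / 4 <-> x = cos (pi / 4).
Proof.
move=> x1; have p0 := pi_gt0 R; split => [<-|->].
  by rewrite acosK ?in_itv.
by rewrite cosK// in_itv/=; apply/andP; split; lra.
Qed.

Lemma ex_angle x y : x ^+ 2 + y ^+ 2 = 1 -> 0 < y ->
  exists s, [/\ 0 < s, s < pi, cos s = x & sin s = y].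
Proof.
move=> xy y0; have x1 : -1 < x < 1 by apply/andP; split; nra.
have x1' : -1 <= x <= 1 by case/andP: x1 => *; apply/andP; split; exact: ltW.
case/andP: (x1) => xl xr; case/andP: (x1') => xl' xr'.
exists (acos x); split.
- by apply: acos_gt0; rewrite xl' xr.
- by apply: acos_ltpi; rewrite xl xr'.
- by rewrite acosK ?in_itv.
- rewrite sin_acos// (_ : 1 - x ^+ 2 = y ^+ 2); last by lra.
  by rewrite sqrtr_sqr gtr0_norm.
Qed.

(** Recovers the order of points on an arc from the sign of a 2 by 2 determinant of their
    coordinates, which is the sine of a difference. *)
Lemma sinB_gt0_lt s t : 0 < s -> s < pi -> 0 < t -> t < pi ->
  0 < sin (t - s) -> s < t.
Proof.
move=> s0 sp t0 tp h; rewrite ltNge; apply/negP => ts.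
suff : 0 <= sin (s - t) by rewrite -opprB sinN; lra.
by apply: sin_ge0_pi; apply/andP; split; lra.
Qed.

End TrigonometricLemmas.

(** * The domain as the spacelike part of the unit sphere *)

Section HilbertDomain.
Variables (R : realType) (n : nat).
Implicit Types (c x y a : 'rV[R]_n.+1).
Local Notation k := (cos (pi / 4) : R).

Lemma usphere_edot_bound x y : usphere x -> usphere y -> -1 <= edot x y <= 1.
Proof.
rewrite /usphere/= => x1 y1; have := edot_cauchy x y.
rewrite x1 y1 mulr1 => h; apply/andP; split; nra.
Qed.

Lemma usphereN x : usphere (- x) <-> usphere x.
Proof. by rewrite /usphere/= edotNl edotNr opprK. Qed.

Lemma small_sphereE c x : usphere c ->
  small_sphere c (pi / 4) x <-> usphere x /\ edot c x = k.
Proof.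
move=> c1; rewrite /small_sphere/= /sdist; split=> -[x1 h]; split=> //;
  exact/(acos_eq_piquarter (usphere_edot_bound c1 x1)).
Qed.

Lemma open_sballE c x : usphere c ->
  open_sball c (pi / 4) x <-> usphere x /\ k < edot c x.
Proof.
move=> c1; rewrite /open_sball/= /sdist; split=> -[x1 h]; split=> //;
  by move: h; rewrite acos_lt_piquarter//; exact: usphere_edot_bound.
Qed.

Lemma opp_imageE (A : set 'rV[R]_n.+1) x : [set - y | y in A] x <-> A (- x).
Proof.
split=> [[y Ay <-]|Ax]; first by rewrite opprK.
by exists (- x) => //; rewrite opprK.
Qed.

Lemma K2E c x : usphere c ->
  K2 (antipodal_pair c (pi / 4)) x <-> usphere x /\ edot c x = - k.
Proof.
move=> c1; rewrite /antipodal_pair/=.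
apply: (iff_trans (opp_imageE _ _)).
apply: (iff_trans (small_sphereE _ c1)).
rewrite edotNr; split=> -[/usphereN x1 h]; split=> //; first by rewrite -h opprK.
by rewrite h opprK.
Qed.

Lemma I2E c x : usphere c ->
  I2 (antipodal_pair c (pi / 4)) x <-> usphere x /\ edot c x < - k.
Proof.
move=> c1; rewrite /antipodal_pair/=.
apply: (iff_trans (opp_imageE _ _)).
apply: (iff_trans (open_sballE _ c1)).
by rewrite edotNr; split=> -[/usphereN x1 h]; split=> //; lra.
Qed.

(** On the unit sphere [cform c x x] equals 1 - 2 (edot c x)^2, which is positive exactly when
    [edot c x] lies strictly between -k and k, since k^2 = 1/2. *)
Lemma hilbert_domainE c x : usphere c ->
  hilbert_domain (antipodal_pair c (pi / 4)) x <->
    usphere x /\ 0 < cform c x x.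
Proof.
move=> c1; have k2 := cos_piquarter_sqr R; have k0 := cos_piquarter_gt0 R.
rewrite /hilbert_domain/= /cform; split=> [[x1 h]|[x1 h]]; split=> //.
- move: (x1); rewrite /usphere/= => ->.
  have [kx|xk] := ltP k (edot c x).
    by exfalso; apply: h; left; right; exact/open_sballE.
  have [kx|xk'] := ltP (edot c x) (- k).
    by exfalso; apply: h; right; right; exact/I2E.
  have [kx|xk2] := eqVneq (edot c x) k.
    by exfalso; apply: h; left; left; exact/small_sphereE.
  have [kx|xk3] := eqVneq (edot c x) (- k).
    by exfalso; apply: h; right; left; exact/K2E.
  have h1 : edot c x < k by rewrite lt_neqAle xk2.
  have h2 : - k < edot c x by rewrite lt_neqAle eq_sym xk3.
  by nra.
- move: h; move: (x1); rewrite {1}/usphere/= => -> h.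
  case=> -[].
  + by move/(small_sphereE _ c1) => -[_ e]; move: h; rewrite e; nra.
  + by move/(open_sballE _ c1) => -[_ e]; nra.
  + by move/(K2E _ c1) => -[_ e]; move: h; rewrite e; nra.
  + by move/(I2E _ c1) => -[_ e]; nra.
Qed.

Lemma cform_small_sphere c x : usphere c -> usphere x ->
  edot c x ^+ 2 = k ^+ 2 -> cform c x x = 0.
Proof.
by rewrite /cform {2}/usphere/= => c1 -> e; have := cos_piquarter_sqr R; lra.
Qed.

End HilbertDomain.

(** * Continuity of the forms and of normalization *)

Section FormContinuity.
Variables (R : realType) (n : nat).
Implicit Types (c : 'rV[R]_n.+1).

(** The filter is arbitrary so that continuity at a point and continuity within an interval are both
    instances. *)
Lemma edot_cvg (T : Type) (F : set_system T) {FF : Filter F}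
    (f g : T -> 'rV[R]_n.+1) x y :
  f @ F --> x -> g @ F --> y -> edot (f t) (g t) @[t --> F] --> edot x y.
Proof.
move=> fx gy.
have coord (h : T -> 'rV[R]_n.+1) (z : 'rV[R]_n.+1) i :
    h @ F --> z -> h t 0 i @[t --> F] --> z 0 i.
  move=> hz; apply: (cvg_comp (G := nbhs z) h (fun M : 'rV[R]_n.+1 => M 0 i)) => //.
  exact: coord_continuous.
apply: (cvg_big (@add_continuous _)) => i _.
by apply: cvgM; exact: coord.
Qed.

Lemma cform_cvg c (T : Type) (F : set_system T) {FF : Filter F}
    (f g : T -> 'rV[R]_n.+1) x y :
  f @ F --> x -> g @ F --> y -> cform c (f t) (g t) @[t --> F] --> cform c x y.
Proof.
move=> fx gy; apply: cvgB; first exact: edot_cvg.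
apply: cvgM; first exact: cvg_cst.
by apply: cvgM; apply: edot_cvg => //; exact: cvg_cst.
Qed.

Lemma invsqrt_cvg (T : Type) (F : set_system T) {FF : Filter F}
    (g : T -> R) (y : R) :
  0 < y -> g @ F --> y -> (Num.sqrt (g t))^-1 @[t --> F] --> (Num.sqrt y)^-1.
Proof.
move=> y0 gy; apply: (cvgV (f := fun t => Num.sqrt (g t))).
  by apply: lt0r_neq0; rewrite sqrtr_gt0.
by apply: (cvg_comp (G := nbhs y) g Num.sqrt) => //; exact: sqrt_continuous.
Qed.

Lemma normalize_continuous (x : 'rV[R]_n.+1) :
  x != 0 -> {for x, continuous (@normalize R n)}.
Proof.
move=> x0; have xx : 0 < edot x x by rewrite -sqrtr_gt0 sqrt_edot_gt0.
have idx : y @[y --> x] --> x by exact: cvg_id.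
exact: (cvgZ (invsqrt_cvg xx (edot_cvg idx idx)) idx).
Qed.

End FormContinuity.

(** * Tangent great hyperspheres of the small sphere *)

Section SupportingHyperplanes.
Variables (R : realType) (n : nat).
Implicit Types (c x y a v u : 'rV[R]_n.+1).
Local Notation k := (cos (pi / 4) : R).

Lemma great_circle_usphere a v z : usphere a -> usphere v -> edot a v = 0 ->
  usphere (great_circle a v z).
Proof.
rewrite /usphere/= /great_circle => a1 v1 av.
rewrite !edotE (edotC v a) a1 v1 av; have := cos2Dsin2 z; lra.
Qed.

(** With Y = [edot c y] > k, [cform_cauchy] bounds the square of [edot a y] - kY by (1 - Y^2)/2 <
    1/4. Hence [edot a y] - kY < 1/2 < kY. *)
Lemma open_sball_tangent c a y : usphere c -> usphere a -> edot c a = k ->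
  usphere y -> k < edot c y -> cform c a y < 0.
Proof.
move=> c1 a1 ca y1 cy; have := cform_cauchy a y c1.
have k2 := cos_piquarter_sqr R; have k0 := cos_piquarter_gt0 R.
rewrite ca /cform ca; move: a1 y1; rewrite /usphere/= => -> ->.
rewrite k2; set e := edot a y; set Y := edot c y in cy * => h.
have Y2 : k ^+ 2 < Y ^+ 2 by nra.
have h2 : (e - k * Y) ^+ 2 < 2^-1 ^+ 2 by nra.
have : e - k * Y < 2^-1.
  by rewrite ltNge; apply/negP => h3; nra.
by nra.
Qed.

(* The sphere [edot a x = 2 <c, a> <c, x>] is tangent to the small sphere at
   [a], so the ball lies on one side of it and is joined to its centre there
   by great circle segments. *)
Lemma tangent_supporting c a : usphere c -> usphere a -> edot c a = k ->
  supporting_hyperplane (small_sphere c (pi / 4)) (open_sball c (pi / 4))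
    (great_hypersphere (a - (2 * edot c a) *: c)).
Proof.
move=> c1 a1 ca; set u := a - _.
have k2 := cos_piquarter_sqr R; have k0 := cos_piquarter_gt0 R.
have uE x : edot u x = cform c a x by rewrite cform_edotE.
have uneg y : usphere y -> k < edot c y -> edot u y < 0.
  by move=> y1 cy; rewrite uE; exact: open_sball_tangent.
have k1 : k < 1 by rewrite ltNge; apply/negP => h; nra.
have uc : edot u c < 0 by apply: uneg => //; move: c1; rewrite /usphere/= => ->.
split.
- exists u => //; apply/eqP => u0; move: uc.
  by rewrite u0 -(scale0r (0 : 'rV[R]_n.+1)) edotZl mul0r ltxx.
- exists a; split; last exact/small_sphereE.
  split=> //; rewrite uE; apply: cform_small_sphere => //; by rewrite ca.
- exists c; first by split=> // -[_ h]; rewrite h ltxx in uc.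
  move=> y /(open_sballE _ c1)[y1 cy].
  have uy := uneg _ y1 cy.
  (* The straight segment from [c] to [y]: the linear functional of [u] stays negative on it, so it
     avoids 0 and its radial projection is a path on one side of the hypersphere. *)
  pose g (t : R) := c + t *: (y - c).
  have gneg t : 0 <= t <= 1 -> edot u (g t) < 0.
    move=> /andP[t0 t1]; rewrite edotDr edotZr edotDr edotNr; move: uc uy.
    set A := edot u c; set B := edot u y => uc uy.
    have -> : A + t * (B - A) = (1 - t) * A + t * B by ring.
    by have [h|h] := ltP t 2^-1; nra.
  have gn0 t : 0 <= t <= 1 -> g t != 0.
    move=> /gneg h; apply/eqP => g0; move: h.
    by rewrite g0 -(scale0r (0 : 'rV[R]_n.+1)) edotZr mul0r ltxx.
  have norm1 x : usphere x -> normalize x = x.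
    by rewrite /usphere/= /normalize => ->; rewrite sqrtr1 invr1 scale1r.
  apply: (@connected_component_max _ _ [set normalize (g t) | t in `[0, 1]]).
  + exists 0; first by rewrite /= in_itv/= lexx ler01.
    by rewrite /g scale0r addr0; exact: norm1.
  + move=> z [t]; rewrite /= in_itv/= => t01 <-; split.
      exact/edot_normalize/gn0.
    move=> [_]; rewrite edotZr => /eqP; rewrite mulf_eq0 invr_eq0 => /orP[/eqP|/eqP].
      by move=> h; have := sqrt_edot_gt0 (gn0 _ t01); rewrite h ltxx.
    by move=> h; have := gneg _ t01; rewrite h ltxx.
  + apply: connected_continuous_connected; first exact: segment_connected.
    apply: continuous_in_subspaceT => t; rewrite inE/= in_itv/= => t01.
    apply: (continuous_comp (f := g) (g := @normalize R n)).
      rewrite /continuous_at.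
      apply: (cvgD (f := cst c) (g := fun s => s *: (y - c))); first exact: cvg_cst.
      by apply: cvgZr_tmp; exact: cvg_id.
    exact/normalize_continuous/gn0.
  + exists 1; first by rewrite /= in_itv/= lexx ler01.
    by rewrite /g scale1r addrC subrK; exact: norm1.
Qed.

End SupportingHyperplanes.

(** * Hilbert chords in terms of null vectors *)

Section HilbertChords.
Variables (R : realType) (n : nat).
Implicit Types (c x y p q a v u : 'rV[R]_n.+1) (L s t z : R).
Local Notation k := (cos (pi / 4) : R).

(** The angle is pi/2 + arctan (w / m). It yields an interior zero of the form along a half circle
    issuing from a null vector. *)
Lemma ex_orthogonal_angle (m w : R) : m != 0 ->
  exists z, [/\ 0 < z, z < pi & cos z * m + sin z * w = 0].
Proof.
move=> m0; set r := atan (w / m).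
have r1 : - (pi / 2) < r := atan_gtNpi2 _.
have r2 : r < pi / 2 := atan_ltpi2 _.
have cr : 0 < cos r by apply: cos_gt0_pihalf; rewrite r1.
have sr : sin r = w / m * cos r.
  have := @atanK R (w / m); rewrite /tan -/r => <-.
  by rewrite divfK//; exact: lt0r_neq0.
exists (r + pi / 2); split; try lra.
by rewrite cosDpihalf sinDpihalf sr; field.
Qed.

(** Since [a] is null, the cos^2 term drops out and sin z factors out, leaving a factor linear in
    cos z and sin z. *)
Lemma cform_great_circle c a v z : cform c a a = 0 ->
  cform c (great_circle a v z) (great_circle a v z) =
    sin z * (cos z * (2 * cform c a v) + sin z * cform c v v).
Proof.
by move=> aa; rewrite /great_circle !cformE aa (cformC c v a); ring.
Qed.

Lemma small_sphere_null c a : usphere c ->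
  small_sphere c (pi / 4) a -> cform c a a = 0.
Proof.
by move=> c1 /(small_sphereE _ c1)[a1 ca]; apply: cform_small_sphere => //; rewrite ca.
Qed.

Lemma K2_null c a : usphere c ->
  K2 (antipodal_pair c (pi / 4)) a -> cform c a a = 0.
Proof.
by move=> c1 /(K2E _ c1)[a1 ca]; apply: cform_small_sphere => //; rewrite ca sqrrN.
Qed.

(* An arc of length [pi] with interior in the domain is tangent to the small
   sphere, hence lies in a supporting hyperplane; a longer one passes through
   [- a]. *)
Lemma chord_length_lt_pi c a v L : usphere c ->
  small_sphere c (pi / 4) a -> usphere v -> edot a v = 0 ->
  K2 (antipodal_pair c (pi / 4)) (great_circle a v L) -> 0 < L ->
  (forall z, 0 < z -> z < L ->
    hilbert_domain (antipodal_pair c (pi / 4)) (great_circle a v z)) ->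
  (forall H, supporting_hyperplane (small_sphere c (pi / 4))
      (open_sball c (pi / 4)) H ->
    ~ ([set great_circle a v z | z in `]0, L[] `<=` H)) ->
  L < pi.
Proof.
move=> c1 Ka v1 av KL L0 dom nsup.
have aa := small_sphere_null c1 Ka.
have pos z : 0 < z -> z < L ->
    0 < sin z * (cos z * (2 * cform c a v) + sin z * cform c v v).
  by move=> z0 zL; have /(hilbert_domainE _ c1)[_] := dom z z0 zL; rewrite cform_great_circle.
rewrite ltNge; apply/negP; rewrite le_eqVlt => /orP[/eqP Lpi|piL]; last first.
  by have := pos _ (pi_gt0 R) piL; rewrite sinpi mul0r ltxx.
(* Length exactly pi: if [cform c a v] is nonzero, the linear factor vanishes at an interior angle,
   against positivity; otherwise the arc lies in the hypersphere tangent at [a]. *)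
have [m0|m0] := eqVneq (cform c a v) 0; last first.
  have m20 : 2 * cform c a v != 0 by rewrite mulf_neq0.
  have [z [z0 zpi e]] := ex_orthogonal_angle (cform c v v) m20.
  by rewrite Lpi in zpi; have := pos _ z0 zpi; rewrite e mulr0 ltxx.
have /(small_sphereE _ c1)[a1 ca] := Ka.
apply: (nsup _ (tangent_supporting c1 a1 ca)) => y [z]; rewrite /= in_itv/= => _ <-.
split; first exact: great_circle_usphere.
by rewrite -cform_edotE /great_circle !cformE aa m0; ring.
Qed.

(** The point at angle z of an arc of length L < pi is (sin (L - z) a1 + sin z a2) / sin L. The
    ratio of sines thus becomes a ratio of coordinates, and the order of the angles becomes the sign
    of a determinant equal to sin (t - s) / sin L. *)
Lemma hilbert_chordP c p q a1 a2 : usphere c ->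
  hilbert_chord (antipodal_pair c (pi / 4)) p q a1 a2 ->
  exists s1 t1 s2 t2 : R,
  [/\ [/\ 0 < s1, 0 < t1, 0 < s2 & 0 < t2],
      [/\ usphere a1, usphere a2, edot c a1 = k & edot c a2 = - k],
      [/\ p = s1 *: a1 + t1 *: a2, q = s2 *: a1 + t2 *: a2 & s2 * t1 < s1 * t2],
      0 < cform c a1 a2
    & (sin (sdist p a2) * sin (sdist q a1)) /
        (sin (sdist q a2) * sin (sdist p a1)) = (s1 * t2) / (s2 * t1)].
Proof.
move=> c1 [v [L [s [t []]]]] [Ka1 Ka2 v1 av a2E] dom nsup [pE qE] [s0 st tL _].
have dom' z : 0 < z -> z < L ->
    hilbert_domain (antipodal_pair c (pi / 4)) (great_circle a1 v z).
  by move=> z0 zL; apply: dom; exists z => //; rewrite /= in_itv/= z0.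
have L0 : 0 < L by lra.
have Lpi : L < pi.
  apply: (@chord_length_lt_pi c a1 v) => //; first by rewrite -a2E.
  by move=> H hH; apply: nsup; left.
have /(small_sphereE _ c1)[a1u ca1] := Ka1.
have /(K2E _ c1)[a2u ca2] := Ka2.
have sin0 z : 0 < z -> z < pi -> 0 < sin z by move=> *; apply: sin_gt0_pi; apply/andP.
have sL := sin0 _ L0 Lpi.
have sL0 : sin L != 0 := lt0r_neq0 sL.
have comb z : great_circle a1 v z =
    (sin (L - z) / sin L) *: a1 + (sin z / sin L) *: a2.
  rewrite a2E /great_circle scalerDr !scalerA addrA -scalerDl sinB.
  by congr (_ *: _ + _ *: _); field.
have dist1 z : 0 < z -> z < L -> sdist (great_circle a1 v z) a1 = z.
  move=> z0 zL; rewrite /sdist /great_circle !edotE (edotC v a1) av.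
  move: a1u; rewrite /usphere/= => ->.
  by rewrite mulr0 mulr1 addr0 cosK// in_itv/=; apply/andP; split; lra.
have dist2 z : 0 < z -> z < L -> sdist (great_circle a1 v z) a2 = L - z.
  move=> z0 zL; have a1a1 : edot a1 a1 = 1 by []; have vv : edot v v = 1 by [].
  have e : edot (great_circle a1 v z) (great_circle a1 v L) = cos (L - z).
    by rewrite /great_circle !edotE (edotC v a1) av a1a1 vv cosB; ring.
  by rewrite /sdist a2E e cosK// in_itv/=; apply/andP; split; lra.
have ss : 0 < sin s by apply: sin0; lra.
have sLs : 0 < sin (L - s) by apply: sin0; lra.
have stt : 0 < sin t by apply: sin0; lra.
have sLt : 0 < sin (L - t) by apply: sin0; lra.
have sts : 0 < sin (t - s) by apply: sin0; lra.
have a11 := small_sphere_null c1 Ka1.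
have a22 := K2_null c1 Ka2.
exists (sin (L - s) / sin L), (sin s / sin L), (sin (L - t) / sin L), (sin t / sin L).
split.
- by split; exact: divr_gt0.
- by [].
- split; [by rewrite pE comb|by rewrite qE comb|].
  rewrite -subr_gt0.
  have -> : sin (L - s) / sin L * (sin t / sin L) -
      sin (L - t) / sin L * (sin s / sin L) = sin (t - s) / sin L.
    by rewrite !sinB; field.
  exact: divr_gt0.
(* As [a1] and [a2] are null, the form at [p] is 2AB times [cform c a1 a2], and it is positive
   because [p] is in the domain. *)
- have sL' : s < L by lra.
  have /(hilbert_domainE _ c1)[_] := dom' _ s0 sL'.
  rewrite comb !cformE a11 a22 (cformC c a2 a1).
  have A0 : 0 < sin (L - s) / sin L by exact: divr_gt0.
  have B0 : 0 < sin s / sin L by exact: divr_gt0.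
  move: A0 B0; set A := _ / _; set B := _ / _ => A0 B0 h.
  have AB : 0 < 2 * (A * B) by rewrite mulr_gt0// mulr_gt0.
  have : 0 < 2 * (A * B) * cform c a1 a2 by lra.
  by rewrite (pmulr_rgt0 _ AB).
- rewrite pE qE !dist1 ?dist2; try lra.
  by field; rewrite !lt0r_neq0.
Qed.

(** [P] and [Q] are the representatives of [p] and [q] on the unit hyperboloid of [cform c]. With E
    = exp d, E^2 is the ratio of coordinates, and expanding the form in the null basis gives (E +
    1/E)/2. *)
Lemma chord_distance c p q P Q a1 a2 (x y : R) : usphere c ->
  hilbert_chord (antipodal_pair c (pi / 4)) p q a1 a2 ->
  p = x *: P -> q = y *: Q -> 0 < x -> 0 < y ->
  cform c P P = 1 -> cform c Q Q = 1 ->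
  let d := 2^-1 * ln ((sin (sdist p a2) * sin (sdist q a1)) /
                     (sin (sdist q a2) * sin (sdist p a1))) in
  [/\ 0 < d, cosh d = cform c P Q & edot c Q < edot c P].
Proof.
move=> c1 /(hilbert_chordP c1).
move=> [s1 [t1 [s2 [t2 [[s10 t10 s20 t20] [a1u a2u ca1 ca2] [pE qE lt] M0 ->]]]]].
move=> pP qQ x0 y0 PP QQ /=.
have a11 : cform c a1 a1 = 0 by apply: cform_small_sphere => //; rewrite ca1.
have a22 : cform c a2 a2 = 0.
  by apply: cform_small_sphere => //; rewrite ca2 sqrrN.
move: M0; set M := cform c a1 a2 => M0.
have x2 : x ^+ 2 = 2 * s1 * t1 * M.
  have : cform c p p = x ^+ 2 by rewrite pP !cformE PP; ring.
  by rewrite pE !cformE a11 a22 (cformC c a2 a1) -/M; lra.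
have y2 : y ^+ 2 = 2 * s2 * t2 * M.
  have : cform c q q = y ^+ 2 by rewrite qQ !cformE QQ; ring.
  by rewrite qE !cformE a11 a22 (cformC c a2 a1) -/M; lra.
have xy : x * y * cform c P Q = (s1 * t2 + s2 * t1) * M.
  have : cform c p q = x * y * cform c P Q by rewrite pP qQ !cformE; ring.
  by rewrite pE qE !cformE a11 a22 (cformC c a2 a1) -/M; lra.
have st10 : 0 < s2 * t1 by exact: mulr_gt0.
set r := s1 * t2 / (s2 * t1).
have r1 : 1 < r by rewrite ltr_pdivlMr// mul1r.
have d0 : 0 < 2^-1 * ln r by rewrite mulr_gt0// ln_gt0.
have E0 : 0 < expR (2^-1 * ln r) by exact: expR_gt0.
have E2 : expR (2^-1 * ln r) ^+ 2 = r.
  rewrite expr2 -expRD (_ : _ + _ = ln r); last by lra.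
  by rewrite lnK// posrE; lra.
split=> //.
- rewrite /cosh expRN; move: E0 E2; set E := expR _ => E0 E2.
  have s1t2 : s1 * t2 = E ^+ 2 * (s2 * t1).
    by rewrite E2 /r divfK//; exact: lt0r_neq0.
  (* Both sides are positive, so it suffices to compare squares, known from [x2], [y2] and E^2 =
     r. *)
  have xyE : x * y = 2 * M * E * (s2 * t1).
    have : (x * y) ^+ 2 = (2 * M * E * (s2 * t1)) ^+ 2.
      have -> : (2 * M * E * (s2 * t1)) ^+ 2 =
        4 * M ^+ 2 * (E ^+ 2 * (s2 * t1)) * (s2 * t1) by ring.
      by rewrite -s1t2 exprMn x2 y2; ring.
    move=> /eqP; rewrite eqrXn2// => [/eqP//||]; first by rewrite ltW ?mulr_gt0.
    by rewrite ltW ?mulr_gt0.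
  rewrite xyE s1t2 in xy.
  have nz : 2 * M * E * (s2 * t1) != 0 by rewrite lt0r_neq0// !mulr_gt0.
  apply: (mulfI nz); rewrite xy; field; exact: lt0r_neq0.
- have k0 := cos_piquarter_gt0 R.
  have cp : x * edot c P = k * (s1 - t1).
    by rewrite -edotZr -pP pE !edotE ca1 ca2; ring.
  have cq : y * edot c Q = k * (s2 - t2).
    by rewrite -edotZr -qQ qE !edotE ca1 ca2; ring.
  (* From [P] to [Q] the coordinate along [a1] decreases and the one along [a2] increases (s2/y <
     s1/x and t1/x < t2/y). As [edot c] is k on [a1] and -k on [a2], it decreases. *)
  have h1 : s2 * x < s1 * y.
    rewrite -(@ltr_pXn2r _ 2) ?nnegrE ?mulr_ge0 ?ltW// !exprMn x2 y2.
    rewrite -subr_gt0.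
    have -> : s1 ^+ 2 * (2 * s2 * t2 * M) - s2 ^+ 2 * (2 * s1 * t1 * M) =
      2 * s1 * s2 * M * (s1 * t2 - s2 * t1) by ring.
    by rewrite !mulr_gt0// subr_gt0.
  have h2 : t1 * y < t2 * x.
    rewrite -(@ltr_pXn2r _ 2) ?nnegrE ?mulr_ge0 ?ltW// !exprMn x2 y2.
    rewrite -subr_gt0.
    have -> : t2 ^+ 2 * (2 * s1 * t1 * M) - t1 ^+ 2 * (2 * s2 * t2 * M) =
      2 * t1 * t2 * M * (s1 * t2 - s2 * t1) by ring.
    by rewrite !mulr_gt0// subr_gt0.
  rewrite -(ltr_pM2l (mulr_gt0 x0 y0)).
  have -> : x * y * edot c Q = x * (y * edot c Q) by ring.
  have -> : x * y * edot c P = y * (x * edot c P) by ring.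
  rewrite cp cq.
  have -> : x * (k * (s2 - t2)) = k * (s2 * x - t2 * x) by ring.
  have -> : y * (k * (s1 - t1)) = k * (s1 * y - t1 * y) by ring.
  by rewrite ltr_pM2l//; lra.
Qed.

(** Converse of [hilbert_chordP]: the arc is the shorter great circle arc from [a1] to [a2], of
    length the angle L between them. *)
Lemma hilbert_chord_cone c p q a1 a2 (s1 t1 s2 t2 : R) : usphere c ->
  usphere a1 -> edot c a1 = k -> usphere a2 -> edot c a2 = - k ->
  0 < cform c a1 a2 ->
  0 < s1 -> 0 < t1 -> 0 < s2 -> 0 < t2 -> s2 * t1 < s1 * t2 ->
  usphere p -> usphere q ->
  p = s1 *: a1 + t1 *: a2 -> q = s2 *: a1 + t2 *: a2 ->
  hilbert_chord (antipodal_pair c (pi / 4)) p q a1 a2.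
Proof.
move=> c1 a1u ca1 a2u ca2 M0 s10 t10 s20 t20 lt pu qu pE qE.
have k0 := cos_piquarter_gt0 R; have k2 := cos_piquarter_sqr R.
have a11 : cform c a1 a1 = 0 by apply: cform_small_sphere => //; rewrite ca1.
have a22 : cform c a2 a2 = 0.
  by apply: cform_small_sphere => //; rewrite ca2 sqrrN.
pose C := edot a1 a2.
(* [cform c a1 a2] equals C + 2k^2 = C + 1; so [a1] and [a2] are not antipodal. They are distinct by
   the sign of [edot c]. *)
have C1 : -1 < C by move: M0; rewrite /cform ca1 ca2 -/C; lra.
have C2 : C < 1.
  have : edot (a1 - a2) (a1 - a2) = 2 - 2 * C.
    rewrite !edotE (edotC a2 a1) -/C; move: a1u a2u; rewrite /usphere/= => -> ->; ring.
  have : edot (a1 - a2) (a1 - a2) != 0.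
    apply/eqP => /edot_eq0/eqP; rewrite subr_eq0 => /eqP e.
    by move: ca2; rewrite -e ca1; lra.
  have := edot_ge0 (a1 - a2).
  by rewrite le_eqVlt eq_sym => /orP[/eqP->|]; [rewrite eqxx|lra].
have S20 : 0 < 1 - C ^+ 2 by nra.
pose S := Num.sqrt (1 - C ^+ 2).
have S0 : 0 < S by rewrite sqrtr_gt0.
have S2 : S ^+ 2 = 1 - C ^+ 2 by rewrite sqr_sqrtr// ltW.
have Sn0 : S != 0 := lt0r_neq0 S0.
have CS : C ^+ 2 + S ^+ 2 = 1 by lra.
have [L [L0 Lpi cL sL]] := ex_angle CS S0.
(* Gram-Schmidt: the unit tangent at [a1] pointing towards [a2]. *)
pose v := S^-1 *: (a2 - C *: a1).
have a2E : a2 = great_circle a1 v L.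
  by rewrite /great_circle cL sL /v scalerA divff// scale1r addrC subrK.
have a1a1 : edot a1 a1 = 1 by [].
have a2a2 : edot a2 a2 = 1 by [].
have av : edot a1 v = 0 by rewrite /v !edotE -/C a1a1; ring.
have vu : usphere v.
  rewrite /usphere/= /v !edotE (edotC a2 a1) -/C a1a1 a2a2.
  transitivity ((1 - C ^+ 2) / S ^+ 2); first by field.
  by rewrite -S2 divff// expf_neq0.
clearbody v.
(* Coordinates in the orthonormal basis [a1], [v]; the positive sine places the angle in ]0, pi[. *)
have angle (x : 'rV[R]_n.+1) (s1' t1' : R) : 0 < s1' -> 0 < t1' -> usphere x ->
    x = s1' *: a1 + t1' *: a2 -> exists z, [/\ 0 < z, z < pi,
      x = great_circle a1 v z, cos z = s1' + t1' * C & sin z = t1' * S].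
  move=> s0 t0 xu xE.
  have xE' : x = (s1' + t1' * C) *: a1 + (t1' * S) *: v.
    rewrite xE {1}a2E /great_circle cL sL scalerDr !scalerA addrA.
    by rewrite -scalerDl.
  have cs : (s1' + t1' * C) ^+ 2 + (t1' * S) ^+ 2 = 1.
    by move: xu; rewrite /usphere/= xE' !edotE (edotC v a1) av vu a1a1 => <-; ring.
  have [z [z0 zpi cz sz]] := ex_angle cs (mulr_gt0 t0 S0).
  by exists z; split=> //; rewrite /great_circle cz sz.
have [s [s0 spi psE cs ss]] := angle p s1 t1 s10 t10 pu pE.
have [t [t0 tpi qtE ct st]] := angle q s2 t2 s20 t20 qu qE.
exists v, L, s, t => arc; split.
- split=> //; first exact/small_sphereE.
  exact/K2E.
- move=> x [z]; rewrite /= in_itv/= => /andP[z0 zL] <-.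
  apply/hilbert_domainE => //; split; first exact: great_circle_usphere.
  have -> : great_circle a1 v z = (sin (L - z) / S) *: a1 + (sin z / S) *: a2.
    rewrite a2E /great_circle cL sL scalerDr !scalerA addrA -scalerDl sinB cL sL.
    by congr (_ *: _ + _ *: _); field.
  have sz : 0 < sin z by apply: sin_gt0_pi; apply/andP; split; lra.
  have sLz : 0 < sin (L - z) by apply: sin_gt0_pi; apply/andP; split; lra.
  rewrite !cformE a11 a22 (cformC c a2 a1).
  have : 0 < (sin (L - z) / S) * (sin z / S) * cform c a1 a2.
    by rewrite !mulr_gt0// invr_gt0.
  by lra.
- move=> H hH sub.
  have pH : H p.
    apply: sub; exists s => //; rewrite /= in_itv/= s0; apply: sinB_gt0_lt => //.
    have -> : sin (L - s) = s1 * S by rewrite sinB cL sL cs ss; ring.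
    exact: mulr_gt0.
  have qH : H q.
    apply: sub; exists t => //; rewrite /= in_itv/= t0; apply: sinB_gt0_lt => //.
    have -> : sin (L - t) = s2 * S by rewrite sinB cL sL ct st; ring.
    exact: mulr_gt0.
  have [u [u0 HE]] : exists u : 'rV[R]_n.+1, u != 0 /\ H = great_hypersphere u.
    by case: hH => -[[u u0 HE] _ _]; exists u.
  have [up uq] : edot u p = 0 /\ edot u q = 0.
    by move: pH qH; rewrite HE => -[_ ?] [_ ?].
  rewrite pE qE !edotE in up uq.
  have D0 : s1 * t2 - s2 * t1 != 0 by apply: lt0r_neq0; rewrite subr_gt0.
  have ua1 : edot u a1 = 0.
    apply: (mulfI D0); rewrite mulr0.
    have -> : (s1 * t2 - s2 * t1) * edot u a1 =
      t2 * (s1 * edot u a1 + t1 * edot u a2) -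
      t1 * (s2 * edot u a1 + t2 * edot u a2) by ring.
    by rewrite up uq; ring.
  have ua2 : edot u a2 = 0.
    apply: (mulfI D0); rewrite mulr0.
    have -> : (s1 * t2 - s2 * t1) * edot u a2 =
      s1 * (s2 * edot u a1 + t2 * edot u a2) -
      s2 * (s1 * edot u a1 + t1 * edot u a2) by ring.
    by rewrite up uq; ring.
  (* A hypersphere containing the arc contains [p] and [q], hence annihilates [a1], [a2] and [w].
     But [w] is the midpoint direction of [a1] and [- a2], two distinct points of the first small
     sphere, so [w] lies in the first open ball and [- w] in the second; a supporting hyperplane
     misses its ball. *)
  pose w := normalize (a1 - a2).
  have w2 : edot (a1 - a2) (a1 - a2) = 2 - 2 * C.
    by rewrite !edotE (edotC a2 a1) -/C a1a1 a2a2; ring.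
  have w0 : a1 - a2 != 0.
    apply/eqP => e; move: w2.
    by rewrite e -(scale0r (0 : 'rV[R]_n.+1)) edotZl mul0r; lra.
  have r0 := sqrt_edot_gt0 w0.
  have r2 : Num.sqrt (edot (a1 - a2) (a1 - a2)) ^+ 2 = 2 - 2 * C.
    by rewrite sqr_sqrtr w2//; lra.
  have wu : usphere w := edot_normalize w0.
  have kw : k < edot c w.
    rewrite /w /normalize edotZr (edotDr a1 (- a2) c) (edotNr a2 c).
    rewrite ca1 ca2 opprK [ltRHS]mulrC ltr_pdivlMr//.
    move: r0 r2; set r := Num.sqrt _ => r0 r2.
    have r22 : r < 2 by rewrite ltNge; apply/negP => h; nra.
    by nra.
  have uw : edot u w = 0 by rewrite /w /normalize !edotE ua1 ua2; ring.
  case: hH => -[_ _ [x _ sub2]].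
  + have /sub2/connected_component_sub[_] : open_sball c (pi / 4) w by exact/open_sballE.
    by rewrite HE; apply.
  + have /sub2/connected_component_sub[_] : I2 (antipodal_pair c (pi / 4)) (- w).
      by apply/I2E => //; split; [exact/usphereN|rewrite edotNr; lra].
    rewrite HE; apply; split; first exact/usphereN.
    by rewrite edotNr uw oppr0.
- by [].
- split=> //; last by have := pi_gt0 R; lra.
  + apply: sinB_gt0_lt => //.
    have -> : sin (t - s) = S * (s1 * t2 - s2 * t1) by rewrite sinB cs ss ct st; ring.
    by rewrite mulr_gt0// subr_gt0.
  + apply: sinB_gt0_lt => //.
    have -> : sin (L - t) = s2 * S by rewrite sinB cL sL ct st; ring.
    exact: mulr_gt0.
Qed.

End HilbertChords.

(** * From two points on the hyperboloid to a Hilbert chord *)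

Section NullFrame.
Variables (R : realType) (n : nat).
Implicit Types (c P Q : 'rV[R]_n.+1) (E : R).
Local Notation k := (cos (pi / 4) : R).

(* The null directions of the plane spanned by [P] and [Q], namely the limits at
   both ends of the hyperbola through [P] and [Q]; [E] is the exponential of
   the hyperbolic angle between [P] and [Q]. *)
Definition past_null E P Q : 'rV[R]_n.+1 := E *: P - Q.
Definition future_null E P Q : 'rV[R]_n.+1 := Q - E^-1 *: P.

Lemma past_nullDfuture E P Q :
  past_null E P Q + future_null E P Q = (E - E^-1) *: P.
Proof. by rewrite /past_null /future_null addrA subrK scalerBl. Qed.

Lemma past_nullDfuture_scale E P Q : E != 0 ->
  E^-1 *: past_null E P Q + E *: future_null E P Q = (E - E^-1) *: Q.
Proof.
by move=> E0; apply/rowP => i; rewrite !mxE; field.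
Qed.

(** With C = (E + 1/E)/2 > 1, Q - P is timelike. If a null vector lay in the wrong half-cone,
    [causal_sign] would make its product with P - Q or Q - P nonnegative, whereas these products are
    (1 + E)(1 - C) and (1 + 1/E)(1 - C). *)
Lemma null_frame c P Q E : usphere c -> 1 < E ->
  cform c P P = 1 -> cform c Q Q = 1 -> cform c P Q = (E + E^-1) / 2 ->
  edot c Q < edot c P ->
  let m1 := past_null E P Q in let m2 := future_null E P Q in
  [/\ cform c m1 m1 = 0, cform c m2 m2 = 0,
      cform c m1 m2 = (E - E^-1) ^+ 2 / 2, 0 < edot c m1 & edot c m2 < 0].
Proof.
move=> c1 E1 PP QQ PQ lt m1 m2.
have E0 : E != 0 by apply: lt0r_neq0; lra.
have Ei : 0 < E^-1 by rewrite invr_gt0; lra.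
have C1 : 1 < (E + E^-1) / 2.
  rewrite -subr_gt0.
  have -> : (E + E^-1) / 2 - 1 = (E - 1) ^+ 2 / (2 * E) by field.
  by apply: divr_gt0; [rewrite exprn_gt0//; lra|lra].
have m11 : cform c m1 m1 = 0.
  by rewrite /m1 /past_null !cformE (cformC c Q P) PP QQ PQ; field.
have m22 : cform c m2 m2 = 0.
  by rewrite /m2 /future_null !cformE (cformC c Q P) PP QQ PQ; field.
have m11' : cform c m1 m1 <= 0 by rewrite m11.
have m22' : cform c m2 m2 <= 0 by rewrite m22.
have dd : cform c (Q - P) (Q - P) <= 0.
  by rewrite !cformE (cformC c Q P) PP QQ PQ; lra.
have d0 : edot c (Q - P) <= 0 by rewrite edotDr edotNr; lra.
split=> //.
- by rewrite /m1 /m2 /past_null /future_null !cformE (cformC c Q P) PP QQ PQ; field.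
- rewrite ltNge; apply/negP => m1le.
  have dd' : cform c (P - Q) (P - Q) <= 0.
    by rewrite -opprB cformNl cformNr opprK.
  have d0' : 0 <= edot c (P - Q) by rewrite edotDr edotNr; lra.
  have := causal_sign c1 dd' m11' d0' m1le.
  rewrite /m1 /past_null !cformE (cformC c Q P) PP QQ PQ.
  move: C1; set C := (E + E^-1) / 2 => C1.
  by nra.
- rewrite ltNge; apply/negP => m2le.
  have := causal_sign c1 m22' dd m2le d0.
  rewrite /m2 /future_null !cformE (cformC c Q P) PP QQ PQ.
  move: C1; set C := (E + E^-1) / 2 => C1.
  by nra.
Qed.

Lemma null_normalize c m : usphere c -> cform c m m = 0 -> m != 0 ->
  edot c (normalize m) ^+ 2 = k ^+ 2.
Proof.
move=> c1 mm m0; have := edot_normalize m0.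
have : cform c (normalize m) (normalize m) = 0 by rewrite !cformE mm; ring.
by rewrite /cform cos_piquarter_sqr; lra.
Qed.

Lemma normalizeK (m : 'rV[R]_n.+1) :
  m != 0 -> m = Num.sqrt (edot m m) *: normalize m.
Proof.
by move=> m0; rewrite scalerA divff ?scale1r//; exact/lt0r_neq0/sqrt_edot_gt0.
Qed.

Lemma cform_neq0 c x : cform c x x != 0 -> x != 0.
Proof.
apply: contra => /eqP ->.
by rewrite -(scale0r (0 : 'rV[R]_n.+1)) cformZl mul0r.
Qed.

Lemma edot_neq0 c x : edot c x != 0 -> x != 0.
Proof.
apply: contra => /eqP ->.
by rewrite -(scale0r (0 : 'rV[R]_n.+1)) edotZr mul0r.
Qed.

Lemma hilbert_lt_normalize c P Q E : usphere c -> 1 < E ->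
  cform c P P = 1 -> cform c Q Q = 1 -> cform c P Q = (E + E^-1) / 2 ->
  edot c Q < edot c P ->
  hilbert_lt (antipodal_pair c (pi / 4)) (normalize P) (normalize Q).
Proof.
move=> c1 E1 PP QQ PQ lt.
have [] := null_frame c1 E1 PP QQ PQ lt.
set m1 := past_null E P Q; set m2 := future_null E P Q.
move=> m11 m22 m12 cm1 cm2.
have k0 := cos_piquarter_gt0 R.
have E0 : E != 0 by apply: lt0r_neq0; lra.
have Ei1 : E^-1 < 1 by rewrite invf_lt1//; lra.
have Ei0 : 0 < E^-1 by rewrite invr_gt0; lra.
have Ep : 0 < E by lra.
have D0 : 0 < E - E^-1 by lra.
have m1n0 : m1 != 0 by apply: (@edot_neq0 c); exact: lt0r_neq0.
have m2n0 : m2 != 0 by apply: (@edot_neq0 c); exact: ltr0_neq0.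
have Pn0 : P != 0 by apply: (@cform_neq0 c); rewrite PP oner_eq0.
have Qn0 : Q != 0 by apply: (@cform_neq0 c); rewrite QQ oner_eq0.
have r1 := sqrt_edot_gt0 m1n0; have r2 := sqrt_edot_gt0 m2n0.
have rP := sqrt_edot_gt0 Pn0; have rQ := sqrt_edot_gt0 Qn0.
have m1E := normalizeK m1n0; have m2E := normalizeK m2n0.
have ca1 : edot c (normalize m1) = k.
  apply/eqP; rewrite -(@eqrXn2 _ 2)// ?ltW//; first exact/eqP/null_normalize.
  by rewrite edotZr mulr_gt0// invr_gt0.
have ca2 : edot c (normalize m2) = - k.
  have : - edot c (normalize m2) = k.
    apply/eqP; rewrite -(@eqrXn2 _ 2)// ?ltW//.
      by rewrite sqrrN; exact/eqP/null_normalize.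
    by rewrite edotZr -mulrN mulr_gt0// ?invr_gt0// oppr_gt0.
  by move=> <-; rewrite opprK.
move: r1 r2 rP rQ m1E m2E.
set l1 := Num.sqrt (edot m1 m1); set l2 := Num.sqrt (edot m2 m2).
set lP := Num.sqrt (edot P P); set lQ := Num.sqrt (edot Q Q).
move=> r1 r2 rP rQ m1E m2E; set D := E - E^-1 in D0 *.
have PE : P = D^-1 *: (m1 + m2).
  by rewrite past_nullDfuture scalerA mulVf ?scale1r//; exact: lt0r_neq0.
have QE : Q = D^-1 *: (E^-1 *: m1 + E *: m2).
  by rewrite past_nullDfuture_scale// scalerA mulVf ?scale1r//; exact: lt0r_neq0.
exists (normalize m1), (normalize m2).
have V x : 0 < x -> 0 < x^-1 :> R by rewrite invr_gt0.
(* Coordinates of [PE] and [QE], rescaled: [l1] and [l2] account for normalizing the null vectors,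
   [lP] and [lQ] for normalizing the points. The determinant condition reduces to E^-1 < E. *)
apply: (@hilbert_chord_cone _ _ _ _ _ _ _
  (lP^-1 * D^-1 * l1) (lP^-1 * D^-1 * l2)
  (lQ^-1 * D^-1 * (E^-1 * l1)) (lQ^-1 * D^-1 * (E * l2))) => //.
- exact: edot_normalize.
- exact: edot_normalize.
- by rewrite /normalize cformZl cformZr m12 !mulr_gt0 ?V// ?exprn_gt0.
- by rewrite !mulr_gt0 ?V.
- by rewrite !mulr_gt0 ?V.
- by rewrite !mulr_gt0 ?V.
- by rewrite !mulr_gt0 ?V.
- rewrite -subr_gt0; have DE : D = E - E^-1 by []; clearbody D.
  have -> : lP^-1 / D * l1 * (lQ^-1 / D * (E * l2)) -
    lQ^-1 / D * (E^-1 * l1) * (lP^-1 / D * l2) =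
    lP^-1 * lQ^-1 * D^-1 * D^-1 * l1 * l2 * D.
    by rewrite [X in _ = _ * X]DE; ring.
  by rewrite !mulr_gt0 ?V.
- exact: edot_normalize.
- exact: edot_normalize.
- by rewrite {1}/normalize -/lP {1}PE {1}m1E {1}m2E !scalerDr !scalerA.
- by rewrite {1}/normalize -/lQ {1}QE {1}m1E {1}m2E !scalerDr !scalerA !mulrA.
Qed.

End NullFrame.

(** * Derivatives of vector-valued curves and of their products *)

Section CurveDerivatives.
Variables (R : realType) (n : nat).
Implicit Types (f g sigma v w : R -> 'rV[R]_n.+1) (a b t : R).

Lemma is_derive_coord f df t i :
  is_derive t 1 f df -> is_derive t 1 (fun s => f s 0 i) (df 0 i).
Proof.
move=> [/cvg_ex[l fl] dfE].
have ldf : l = df by rewrite -dfE; apply/esym/cvg_lim.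
rewrite ldf in fl.
have h : h^-1 *: (((fun s => f s 0 i) \o shift t) (h *: (1 : R)) - f t 0 i)
    @[h --> (0 : R)^'] --> df 0 i.
  have := cvg_comp _ (fun M : 'rV[R]_n.+1 => M 0 i) fl (@coord_continuous _ _ _ 0 i df).
  apply: cvg_trans; apply: near_eq_cvg; near=> h.
  by rewrite /= !mxE.
by split; [apply/cvg_ex; exists (df 0 i)|apply/cvg_lim].
Unshelve. all: by end_near. Qed.

Lemma is_derive_edot f df g dg t : is_derive t 1 f df -> is_derive t 1 g dg ->
  is_derive t 1 (fun s => edot (f s) (g s)) (edot df (g t) + edot (f t) dg).
Proof.
move=> hf hg.
have -> : (fun s => edot (f s) (g s)) =
    \sum_(i < n.+1) ((fun s => f s 0 i) * (fun s => g s 0 i)).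
  by rewrite fct_sumE; apply/funext => s; apply: eq_bigr.
rewrite /edot -big_split/=.
apply: is_derive_sum => i.
have h := is_deriveM (is_derive_coord i hf) (is_derive_coord i hg).
by apply: (is_derive_eq h); rewrite [RHS]addrC (mulrC (df 0 i)).
Qed.

Lemma is_derive_cform c f df g dg t : is_derive t 1 f df -> is_derive t 1 g dg ->
  is_derive t 1 (fun s => cform c (f s) (g s)) (cform c df (g t) + cform c (f t) dg).
Proof.
move=> hf hg.
have hc := is_derive_cst c t (1 : R).
have := is_deriveB (is_derive_edot hf hg)
  (is_deriveZ 2 (is_deriveM (is_derive_edot hc hf) (is_derive_edot hc hg))).
move=> h; apply: (is_derive_eq h).
rewrite -!(scale0r c) !edotZl /cform /GRing.scale/= /cst; ring.
Qed.

Lemma is_derive_scalel (h : R -> R) (dh t : R) (m : 'rV[R]_n.+1) :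
  is_derive t 1 h dh -> is_derive t 1 (fun s => h s *: m) (dh *: m).
Proof.
move=> [/cvg_ex[l hl] dhE].
have ldh : l = dh by rewrite -dhE; apply/esym/cvg_lim.
rewrite ldh in hl.
have fm : k^-1 *: (((fun s => h s *: m) \o shift t) (k *: (1 : R)) - h t *: m)
    @[k --> (0 : R)^'] --> dh *: m.
  apply: cvg_trans (cvgZr_tmp (a := m) hl); apply: near_eq_cvg; near=> k.
  by rewrite /= -scalerBl scalerA.
by split; [apply/cvg_ex; exists (dh *: m)|apply/cvg_lim].
Unshelve. all: by end_near. Qed.

Lemma is_derive0_within_cst (h : R -> R) a b :
  {within `[a, b], continuous h} ->
  (forall t, t \in `]a, b[ -> is_derive t 1 h 0) ->
  forall t, t \in `[a, b] -> h t = h a.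
Proof.
move=> ch dh t; rewrite in_itv/= => /andP[at_ tb].
have := @MVT_segment R h (cst 0) a t at_.
case.
- move=> x; rewrite in_itv/= => /andP[ax xt]; apply: dh.
  by rewrite in_itv/= ax (lt_le_trans xt).
- apply: continuous_subspaceW ch => x; rewrite /= !in_itv/= => /andP[-> xt].
  exact: le_trans xt tb.
- by move=> x _ /=; rewrite mul0r => /eqP; rewrite subr_eq0 => /eqP.
Qed.

(** Differentiation along a curve yields identities at interior times only; one-sided limits carry
    them to the endpoints. *)
Lemma within_closure_eq (h : R -> R) a b (l : R) : a < b ->
  {within `[a, b], continuous h} ->
  (forall t, t \in `]a, b[ -> h t = l) ->
  forall t, t \in `[a, b] -> h t = l.
Proof.
move=> ab ch hl t; move/(continuous_within_itvP _ ab) : ch => [_ ha hb].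
rewrite in_itv/= => /andP[]; rewrite le_eqVlt => /predU1P[<- _|at_].
  have ha' : h @ a^'+ --> l.
    apply: cvg_near_cst; near=> x; apply: hl; rewrite in_itv/=.
    by apply/andP; split; near: x; [exact: nbhs_right_gt|exact: nbhs_right_lt].
  exact: (cvg_unique _ ha ha').
rewrite le_eqVlt => /predU1P[->|tb]; last by apply: hl; rewrite in_itv/= at_.
have hb' : h @ b^'- --> l.
  apply: cvg_near_cst; near=> x; apply: hl; rewrite in_itv/=.
  by apply/andP; split; near: x; [exact: nbhs_left_gt|exact: nbhs_left_lt].
exact: (cvg_unique _ hb hb').
Unshelve. all: by end_near. Qed.

Lemma within_edot (A : set R) f g : {within A, continuous f} ->
  {within A, continuous g} -> {within A, continuous (fun t => edot (f t) (g t))}.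
Proof. by move=> cf cg x; apply: edot_cvg; [exact: cf|exact: cg]. Qed.

Lemma within_cform c (A : set R) f g : {within A, continuous f} ->
  {within A, continuous g} -> {within A, continuous (fun t => cform c (f t) (g t))}.
Proof. by move=> cf cg x; apply: cform_cvg; [exact: cf|exact: cg]. Qed.

End CurveDerivatives.

(** * Length and existence of timelike geodesics *)

Section DeSitterGeodesics.
Variables (R : realType) (n : nat).
Implicit Types (p q x y w : 'rV[R]_n.+1) (sigma v : R -> 'rV[R]_n.+1).
Implicit Types (a b t : R).

Definition time_axis : 'rV[R]_n.+1 := delta_mx 0 ord0.
Local Notation e0 := time_axis.

Lemma edot_time_axis x : edot e0 x = x 0 ord0.
Proof.
rewrite /edot big_ord_recl big1 ?addr0 ?mxE ?eqxx ?mul1r// => i _.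
by rewrite mxE/= mul0r.
Qed.

Lemma usphere_time_axis : usphere e0.
Proof. by rewrite /usphere/= edot_time_axis mxE !eqxx. Qed.

Lemma lorentzE x y : lorentz x y = cform e0 x y.
Proof.
by rewrite /lorentz /cform !edot_time_axis /edot big_ord_recl; ring.
Qed.

(** Differentiating <sigma, sigma> = 1 twice gives <sigma, v> = 0 and <acc, sigma> = - <v, v>. The
    acceleration is therefore - <v, v> sigma, so the speed is a constant K and the length is K (b -
    a). *)
Lemma geodesic_cosh a b sigma v : timelike_geodesic a b sigma v ->
  let d := lorentz_length a b v in
  0 < d /\ cosh d = lorentz (sigma a) (sigma b).
Proof.
move=> [ab dS [csigma cv dsigma] fut [acc [_ cacc dv] orth]].
have aab : a \in `[a, b] by rewrite in_itv/= lexx ltW.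
have bab : b \in `[a, b] by rewrite in_itv/= lexx ltW.
have oc t : t \in `]a, b[ -> t \in `[a, b] by exact: subset_itv_oo_cc.
have ss t : t \in `[a, b] -> cform e0 (sigma t) (sigma t) = 1.
  by move=> /dS; rewrite /deSitter/= lorentzE.
have sv t : t \in `[a, b] -> cform e0 (sigma t) (v t) = 0.
  move: t; apply: within_closure_eq => //; first exact: within_cform.
  move=> t tab.
  have h1 := is_derive_cform e0 (dsigma t tab) (dsigma t tab).
  have h2 : is_derive t 1 (fun s => cform e0 (sigma s) (sigma s)) 0.
    have e : \forall s \near t, cst (1 : R) s = cform e0 (sigma s) (sigma s).
      by near=> s; rewrite ss//; apply: oc; near: s; exact: near_in_itvoo.
    exact: (near_eq_is_derive e (is_derive_cst (1 : R) t (1 : R))).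
  by have := @derive_val _ _ _ _ _ _ _ h1; rewrite derive_val (cformC _ (v t)); lra.
have sacc t : t \in `]a, b[ -> cform e0 (acc t) (sigma t) = - cform e0 (v t) (v t).
  move=> tab.
  have h1 := is_derive_cform e0 (dsigma t tab) (dv t tab).
  have h2 : is_derive t 1 (fun s => cform e0 (sigma s) (v s)) 0.
    have e : \forall s \near t, cst (0 : R) s = cform e0 (sigma s) (v s).
      by near=> s; rewrite sv//; apply: oc; near: s; exact: near_in_itvoo.
    exact: (near_eq_is_derive e (is_derive_cst (0 : R) t (1 : R))).
  by have := @derive_val _ _ _ _ _ _ _ h1; rewrite derive_val (cformC _ (acc t)); lra.
(* The acceleration is normal, hence a multiple of the position. *)
have accE t y : t \in `]a, b[ ->
    cform e0 (acc t) y = - cform e0 (v t) (v t) * cform e0 (sigma t) y.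
  move=> tab; have tab' := oc _ tab.
  (* The geodesic equation is tested on the tangential part of [y]. *)
  have := orth t tab' (y - cform e0 (sigma t) y *: sigma t).
  rewrite !lorentzE !cformE ss// sacc// mulr1 subrr => /(_ erefl).
  by lra.
have vv t : t \in `[a, b] -> cform e0 (v t) (v t) = cform e0 (v a) (v a).
  move: t; apply: is_derive0_within_cst; first exact: within_cform.
  move=> t tab; have h := is_derive_cform e0 (dv t tab) (dv t tab).
  apply: (is_derive_eq h).
  by rewrite (cformC _ (v t)) accE// sv ?oc//; ring.
pose K := Num.sqrt (- cform e0 (v a) (v a)).
have va : 0 < - cform e0 (v a) (v a).
  by have [] := fut a aab; rewrite lorentzE oppr_gt0.
have K0 : 0 < K by rewrite sqrtr_gt0.
have K2 : - cform e0 (v a) (v a) = K ^+ 2 by rewrite sqr_sqrtr// ltW.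
have -> : lorentz_length a b v = K * (b - a).
  rewrite /lorentz_length -[RHS](_ : Rintegral lebesgue_measure `[a, b] (cst K) = _).
    apply: eq_Rintegral => t; rewrite inE/= => tab.
    by rewrite lorentzE vv.
  by rewrite Rintegral_cst//= lebesgue_measure_itv/= lte_fin ab.
split; first by rewrite mulr_gt0// subr_gt0.
set p := sigma a.
have cstp : {within `[a, b], continuous (cst p : R -> 'rV[R]_n.+1)}.
  by apply: continuous_subspaceT => x; exact: cvg_cst.
(* For [e = 1] and [e = -1], the two first integrals of [g'' = K^2 g], where
   [g t] is the product of [p] and [sigma t]. *)
have fact (e : R) : e ^+ 2 = 1 ->
    (cform e0 p (v b) + e * K * cform e0 p (sigma b)) * expR (- (e * K) * b) =
    e * K * expR (- (e * K) * a).
  move=> e2.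
  pose phi t := (cform e0 p (v t) + e * K * cform e0 p (sigma t)) *
    expR (- (e * K) * t).
  suff : phi b = phi a by rewrite /phi sv// ss// => ->; ring.
  apply: is_derive0_within_cst bab.
    move=> t; apply: cvgM.
      apply: cvgD; first exact: within_cform.
      by apply: cvgM; [exact: cvg_cst|exact: within_cform].
    apply: continuous_subspaceT => {}t.
    apply: (continuous_comp (f := fun s => - (e * K) * s)); last exact: continuous_expR.
    by apply: cvgM; [exact: cvg_cst|exact: cvg_id].
  move=> t tab.
  have hp := is_derive_cst p t (1 : R).
  have hv := is_derive_cform e0 hp (dv t tab).
  have hs := is_derive_cform e0 hp (dsigma t tab).
  have hl := is_deriveZ (- (e * K)) (is_derive_id t (1 : R)).
  have he := is_derive1_comp (is_derive_expR _) hl.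
  have := is_deriveM (is_deriveD hv (is_deriveZ (e * K) hs)) he.
  move=> h; apply: (is_derive_eq h).
  rewrite /= /cst (cformC _ p (acc t)) accE// vv ?oc// K2.
  have c0 y : cform e0 0 y = 0 by rewrite -(scale0r y) cformZl mul0r.
  rewrite !c0 (cformC _ (sigma t) p) /GRing.scale/=.
  rewrite -[(_ + _) t]/(cform e0 p (v t) + e * K * cform e0 p (sigma t)).
  set W := expR _; set X := cform e0 p (v t); set Y := cform e0 p (sigma t).
  by transitivity (W * K ^+ 2 * Y * (1 - e ^+ 2)); [ring|rewrite e2 subrr mulr0].
have h1 := fact 1 (expr1n _ _).
have em : (-1 : R) ^+ 2 = 1 by rewrite sqrrN expr1n.
have h2 := fact (-1) em.
move: h1 h2; rewrite !mul1r !mulN1r !opprK !mulNr !expRN.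
have -> : cosh (K * (b - a)) =
    (expR (K * b) / expR (K * a) + expR (K * a) / expR (K * b)) / 2.
  by rewrite /cosh mulrBr opprB !expRD !expRN.
rewrite lorentzE; set X := cform e0 p (v b); set Y := cform e0 p (sigma b).
have A0 : expR (K * a) != 0 := lt0r_neq0 (expR_gt0 _).
have B0 : expR (K * b) != 0 := lt0r_neq0 (expR_gt0 _).
move: A0 B0; set A := expR (K * a); set B := expR (K * b) => A0 B0 h1 h2.
have Kn0 : K != 0 := lt0r_neq0 K0.
(* Subtracting the two first integrals eliminates the velocity term X and leaves 2KY = K (B/A +
   A/B). *)
have e1 : X + K * Y = K * B / A.
  by apply: (mulIf (invr_neq0 B0)); rewrite h1; field; rewrite A0 B0.
have e2 : X - K * Y = - (K * A / B).
  by apply: (mulIf B0); rewrite h2; field; rewrite B0.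
apply: (mulfI Kn0); lra.
Unshelve. all: by end_near. Qed.


(** The geodesic is the branch of hyperbola with null asymptotes [m1], [m2]. [null_frame] orders
    points by decreasing product with the axis, so it is applied to [- p] and [- q]. *)
Lemma null_geodesic p q (E : R) : 1 < E ->
  lorentz p p = 1 -> lorentz q q = 1 -> lorentz p q = (E + E^-1) / 2 ->
  p 0 ord0 < q 0 ord0 ->
  exists sigma v, [/\ timelike_geodesic 0 (ln E) sigma v, sigma 0 = p & sigma (ln E) = q].
Proof.
rewrite !lorentzE -!edot_time_axis => E1 pp qq pq lt.
have := @null_frame R n e0 (- p) (- q) E usphere_time_axis E1.
rewrite !cformNl !cformNr !opprK !edotNr ltrN2 => /(_ pp qq pq lt).
set m1 := past_null E (- p) (- q); set m2 := future_null E (- p) (- q).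
move=> [m11 m22 m12 cm1 cm2].
have Ep : 0 < E by lra.
have En0 : E != 0 := lt0r_neq0 Ep.
have D0 : 0 < E - E^-1 by rewrite subr_gt0 (@lt_trans _ _ 1)// invf_lt1.
have Dn0 := lt0r_neq0 D0.
have sum0 := past_nullDfuture E (- p) (- q); rewrite -/m1 -/m2 in sum0.
have sum1 := past_nullDfuture_scale (- p) (- q) En0; rewrite -/m1 -/m2 in sum1.
clearbody m1 m2; set D := E - E^-1 in D0 Dn0 m12 sum0 sum1; clearbody D.
(* Differentiation turns [curve e] into [curve (- e)], and the form is constantly - e on [curve e].
   So [curve (-1)] is the geodesic, [curve 1] its velocity of unit speed, and the acceleration is
   the position again. *)
pose curve (e : R) (t : R) : 'rV[R]_n.+1 :=
  (e * D^-1 * expR (- t)) *: m1 + (- D^-1 * expR t) *: m2.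
have dcurve e t : is_derive t 1 (curve e) (curve (- e) t).
  have h1 := is_derive1_comp (is_derive_expR _) (is_deriveNid t (1 : R)).
  have h2 := is_derive_scalel m1 (is_deriveZ (e * D^-1) h1).
  have h3 := is_derive_scalel m2 (is_deriveZ (- D^-1) (is_derive_expR t)).
  apply: (is_derive_eq (is_deriveD h2 h3)).
  by rewrite /curve; congr (_ *: _ + _ *: _); rewrite /GRing.scale/=; ring.
have ccurve e : continuous (curve e).
  move=> t; apply/differentiable_continuous/derivable1_diffP.
  by have [] := dcurve e t.
have eform e t : cform e0 (curve e t) (curve e t) = - e.
  rewrite /curve !cformE m11 m22 (cformC _ m2) m12 expRN.
  by have := lt0r_neq0 (expR_gt0 t); set T := expR t => T0; field; rewrite Dn0 T0.
have dS t : deSitter (curve (-1) t) by rewrite /deSitter/= lorentzE eform opprK.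
have c1 e : C1_on 0 (ln E) (curve e) (curve (- e)).
  by split; [exact: continuous_subspaceT|exact: continuous_subspaceT|move=> t _].
exists (curve (-1)), (curve (- -1)); split.
- split=> //.
  + by rewrite ln_gt0.
  + move=> t _; split; first by rewrite lorentzE eform opprK; lra.
    rewrite -edot_time_axis /curve !edotE opprK mul1r.
    have T1 := expR_gt0 (- t); have T2 := expR_gt0 t.
    have Di : 0 < D^-1 by rewrite invr_gt0.
    have : 0 < D^-1 * expR (- t) * edot e0 m1 by rewrite !mulr_gt0.
    have : 0 < D^-1 * expR t * - edot e0 m2 by rewrite !mulr_gt0// oppr_gt0.
    by lra.
  + exists (curve (- - -1)) => //.
    by move=> t _ x; rewrite !opprK.
- rewrite /curve oppr0 expR0 !mulr1 mulN1r -scalerDr sum0 scalerA.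
  by rewrite mulNr mulVf// scaleN1r opprK.
- rewrite /curve expRN lnK ?posrE// mulN1r -!scalerA -scalerDr sum1 scalerA.
  by rewrite mulNr mulVf// scaleN1r opprK.
Qed.

End DeSitterGeodesics.

(** * The causal future in de Sitter space *)

Section CausalFuture.
Variables (R : realType) (n : nat).
Implicit Types (p q x y w : 'rV[R]_n.+1) (sigma v : R -> 'rV[R]_n.+1).
Local Notation e0 := (time_axis R n).

(** Together with the next lemma, this presents the open future cone as an intersection of
    half-spaces with normals e0 - w; such linear conditions can be integrated along a curve. *)
Lemma future_timelike_edot_gt0 w x : edot e0 w = 0 -> edot w w <= 1 ->
  future_timelike x -> 0 < edot (e0 - w) x.
Proof.
rewrite /future_timelike lorentzE /cform -edot_time_axis => w0 w1 [xx x0].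
have := cform_cauchy w x (usphere_time_axis R n).
rewrite w0 expr0n/= !subr0 mul0r subr0 edotDl edotNl subr_gt0 => h.
have : edot w x ^+ 2 < edot e0 x ^+ 2.
  have xpos : 0 <= edot x x - edot e0 x ^+ 2.
    have := edot_ge0 (x - edot e0 x *: e0).
    rewrite !edotE (edotC x e0) (usphere_time_axis R n : edot e0 e0 = 1); lra.
  apply: le_lt_trans h _; apply: (@le_lt_trans _ _ (edot x x - edot e0 x ^+ 2)).
    by have w2 := edot_ge0 w; nra.
  by lra.
by move=> h2; rewrite ltNge; apply/negP => h3; nra.
Qed.

(** The extremal [w] is the unit vector along the spatial part of [x], or 0 if that part
    vanishes. *)
Lemma edot_gt0_future_timelike x :
  (forall w, edot e0 w = 0 -> edot w w <= 1 -> 0 < edot (e0 - w) x) ->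
  future_timelike x.
Proof.
rewrite /future_timelike lorentzE /cform -edot_time_axis => h.
pose y := x - edot e0 x *: e0.
have ee : edot e0 e0 = 1 := usphere_time_axis R n.
have ey : edot e0 y = 0 by rewrite /y !edotE ee; ring.
have yx : edot y x = edot y y.
  by rewrite {3}/y edotDr edotNr edotZr (edotC y e0) ey; ring.
have yy : edot y y = edot x x - edot e0 x ^+ 2.
  by rewrite -yx /y !edotE; ring.
have [y0|y0] := eqVneq y 0.
  have : 0 < edot (e0 - 0) x.
    by apply: h; rewrite -(scale0r (0 : 'rV[R]_n.+1)) edotZr !mul0r.
  rewrite subr0 => x0; split=> //.
  by move: yy; rewrite y0 -(scale0r (0 : 'rV[R]_n.+1)) edotZr mul0r; nra.
have r0 := sqrt_edot_gt0 y0.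
have r2 : Num.sqrt (edot y y) ^+ 2 = edot y y by rewrite sqr_sqrtr// edot_ge0.
have : 0 < edot (e0 - normalize y) x.
  apply: h; first by rewrite edotZr ey mulr0.
  by rewrite edot_normalize.
rewrite edotDl edotNl edotZl yx -{2}r2 expr2 mulKf ?lt0r_neq0// => h1.
by split; nra.
Qed.

Lemma C1_edot_lt (a b : R) sigma v w : a < b -> C1_on a b sigma v ->
  (forall t, t \in `[a, b] -> 0 < edot w (v t)) ->
  edot w (sigma a) < edot w (sigma b).
Proof.
move=> ab [cs cv ds] pos.
have dw t : t \in `]a, b[ -> is_derive t 1 (fun s => edot w (sigma s)) (edot w (v t)).
  move=> tab; have h := is_derive_edot (is_derive_cst w t (1 : R)) (ds t tab).
  by apply: (is_derive_eq h); rewrite -(scale0r w) edotZl mul0r add0r.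
have cw : {within `[a, b], continuous (fun s => edot w (sigma s))}.
  by apply: within_edot => //; apply: continuous_subspaceT => x; exact: cvg_cst.
have [t tab e] := MVT ab dw cw.
by rewrite -subr_gt0 e mulr_gt0 ?subr_gt0// pos//; exact: subset_itv_oo_cc.
Qed.

(** Each functional [edot (e0 - w)] strictly increases along every C^1 piece, hence from [p] to
    [q]. *)
Lemma in_future_timelike p q : in_future p q -> future_timelike (q - p).
Proof.
move=> [k [s [sigma [[k0 slt _ pieces] <- <-]]]].
apply: edot_gt0_future_timelike => w w0 w1.
rewrite edotDr edotNr subr_gt0.
have step i : (i < k)%N -> edot (e0 - w) (sigma (s i)) < edot (e0 - w) (sigma (s i.+1)).
  move=> ik; have [v C1v fut] := pieces i ik.
  by apply: (C1_edot_lt (slt i ik) C1v) => t /fut; exact: future_timelike_edot_gt0.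
have : forall j, (j < k)%N ->
    edot (e0 - w) (sigma (s 0%N)) < edot (e0 - w) (sigma (s j.+1)).
  elim=> [|j IH] jk; first exact: step.
  by apply: lt_trans (IH (ltnW jk)) (step _ jk).
by case: k k0 {slt pieces step} => // k _; apply.
Qed.

Lemma geodesic_in_future (a b : R) sigma v :
  timelike_geodesic a b sigma v -> in_future (sigma a) (sigma b).
Proof.
move=> [ab dS C1 fut _]; exists 1%N, (fun i => if i is 0%N then a else b), sigma.
split=> //; split=> // [[|//] _|[|//] _] //.
by exists v.
Qed.

(** On de Sitter space <q - p, q - p> = 2 - 2 <p, q>, so q - p is timelike exactly when <p, q> > 1.
    Conversely a geodesic with E = exp d, cosh d = <p, q>, joins the points. *)
Lemma in_futureP p q : deSitter p -> deSitter q ->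
  in_future p q <-> 1 < lorentz p q /\ p 0 ord0 < q 0 ord0.
Proof.
rewrite /deSitter/= => pp qq; split=> [/in_future_timelike|[h lt]].
  rewrite /future_timelike !lorentzE -!edot_time_axis.
  rewrite lorentzE in pp; rewrite lorentzE in qq.
  rewrite !cformE (cformC _ q p) pp qq edotDr edotNr => -[? ?].
  by split; lra.
have [d d0 dE] := cosh_surj h.
have E1 : 1 < expR d by rewrite expR_gt1.
have pq : lorentz p q = (expR d + (expR d)^-1) / 2 by rewrite -expRN -/(cosh d).
have [sigma [v [geo <- <-]]] := null_geodesic E1 pp qq pq lt.
exact: geodesic_in_future geo.
Qed.

End CausalFuture.

(** * Reflections, which rotate the time axis *)

Section Reflection.
Variables (R : realType) (n : nat).
Implicit Types (c w x y : 'rV[R]_n.+1).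

(* For [w = 0] this is the identity, since [x / 0 = 0]. *)
Definition reflect_along w x : 'rV[R]_n.+1 :=
  x - (2 * edot w x / edot w w) *: w.

Lemma reflect_alongZ w (k : R) x :
  reflect_along w (k *: x) = k *: reflect_along w x.
Proof.
rewrite /reflect_along edotZr scalerBr scalerA; congr (_ - _ *: _); ring.
Qed.

Lemma edot_reflect w x y :
  edot (reflect_along w x) (reflect_along w y) = edot x y.
Proof.
rewrite /reflect_along; have [w0|w0] := eqVneq (edot w w) 0.
  by rewrite w0 invr0 !mulr0 !scale0r !subr0.
by rewrite !edotE (edotC x w); field.
Qed.

Lemma reflect_alongK w : involutive (reflect_along w).
Proof.
move=> x; rewrite {1}/reflect_along.
have [w0|w0] := eqVneq (edot w w) 0.
  by rewrite w0 invr0 !mulr0 !scale0r !subr0 /reflect_along w0 invr0 mulr0 scale0r subr0.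
have -> : edot w (reflect_along w x) = - edot w x.
  by rewrite /reflect_along edotDr edotNr edotZr divfK//; ring.
by rewrite /reflect_along mulrN mulNr scaleNr opprK subrK.
Qed.

(** The reflection along x + c sends [c] to [- x]; when x = - c it is the identity, and the formula
    persists. *)
Lemma edot_reflect_sum c x y : usphere c -> usphere x ->
  edot c (reflect_along (x + c) y) = - edot x y.
Proof.
rewrite /usphere/= => c1 x1; rewrite /reflect_along.
have [w0|w0] := eqVneq (edot (x + c) (x + c)) 0.
  rewrite w0 invr0 mulr0 scale0r subr0.
  have /eqP := edot_eq0 w0; rewrite addrC addr_eq0 => /eqP ->.
  by rewrite edotNl.
move: w0; rewrite !edotE (edotC c x) c1 x1 => w0.
by field; move: w0; apply: contra => /eqP h; apply/eqP; lra.
Qed.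

Lemma reflect_continuous w : continuous (reflect_along w).
Proof.
move=> x; have idx : y @[y --> x] --> x by exact: cvg_id.
have cw : cst w @ x --> w by exact: cst_continuous.
exact: (cvgB idx (cvgZr_tmp (a := w)
  (cvgMr_tmp (b := (edot w w)^-1) (cvgMl_tmp (a := 2) (edot_cvg cw idx))))).
Qed.

End Reflection.

(** * The radial projection onto the Hilbert domain *)

Section HilbertModel.
Variables (R : realType) (n : nat) (c : 'rV[R]_n.+1).
Hypothesis c1 : usphere c.
Local Notation e0 := (time_axis R n).
Local Notation pair := (antipodal_pair c (pi / 4)).

(* The isometry takes the future direction to [- c], because the Hilbert arcs
   run from [K_1], around [c], to [K_2], around [- c]. *)
Definition to_axis : 'rV[R]_n.+1 -> 'rV[R]_n.+1 := reflect_along (e0 + c).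
Definition to_sphere p : 'rV[R]_n.+1 := normalize (to_axis p).
Definition of_sphere y : 'rV[R]_n.+1 :=
  (Num.sqrt (cform c y y))^-1 *: to_axis y.

Lemma edot_to_axis p : edot c (to_axis p) = - p 0 ord0.
Proof. by rewrite edot_reflect_sum ?edot_time_axis//; exact: usphere_time_axis. Qed.

(** The reflection preserves [edot] and carries the time axis to [- c]; the sign cancels in the
    quadratic time term. *)
Lemma cform_to_axis p q : cform c (to_axis p) (to_axis q) = lorentz p q.
Proof.
by rewrite lorentzE /cform !edot_to_axis edot_reflect !edot_time_axis mulrNN.
Qed.

Lemma to_axis_neq0 p : deSitter p -> to_axis p != 0.
Proof.
rewrite /deSitter/= -cform_to_axis => h.
by apply: (@cform_neq0 _ _ c); rewrite h oner_eq0.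
Qed.

Lemma to_sphere_domain p : deSitter p -> hilbert_domain pair (to_sphere p).
Proof.
move=> dp; have p0 := to_axis_neq0 dp.
apply/hilbert_domainE => //; split; first exact: edot_normalize.
rewrite /to_sphere /normalize cformZl cformZr cform_to_axis dp mulr1.
by rewrite mulr_gt0 ?invr_gt0 ?sqrt_edot_gt0.
Qed.

Lemma to_sphereK p : deSitter p -> of_sphere (to_sphere p) = p.
Proof.
move=> dp; have r0 := sqrt_edot_gt0 (to_axis_neq0 dp).
rewrite /of_sphere /to_sphere {2}/normalize /to_axis reflect_alongZ reflect_alongK.
rewrite -/(to_axis p) /normalize cformZl cformZr cform_to_axis dp mulr1.
rewrite -expr2 sqrtr_sqr gtr0_norm ?invr_gt0// scalerA invrK mulfV ?scale1r//.
exact: lt0r_neq0.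
Qed.

Lemma of_sphereK y : hilbert_domain pair y ->
  deSitter (of_sphere y) /\ to_sphere (of_sphere y) = y.
Proof.
move=> /(hilbert_domainE _ c1)[y1 yy].
have r0 : 0 < (Num.sqrt (cform c y y))^-1 by rewrite invr_gt0 sqrtr_gt0.
have e : to_axis (of_sphere y) = (Num.sqrt (cform c y y))^-1 *: y.
  by rewrite /of_sphere /to_axis reflect_alongZ reflect_alongK.
split.
  rewrite /deSitter/= -cform_to_axis e cformZl cformZr mulrA -invfM -expr2.
  by rewrite sqr_sqrtr ?ltW// mulVf// lt0r_neq0.
rewrite /to_sphere e /normalize edotZl edotZr (y1 : edot y y = 1) mulr1.
rewrite -expr2 sqrtr_sqr gtr0_norm// scalerA mulVf ?scale1r//.
exact: lt0r_neq0.
Qed.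

Lemma to_sphere_homeomorphism :
  homeomorphism_on (@deSitter R n) (hilbert_domain pair) to_sphere.
Proof.
split; [split|split].
- exact: to_sphere_domain.
- move=> p q; rewrite !inE => dp dq e.
  by rewrite -(to_sphereK dp) e to_sphereK.
- by move=> y /of_sphereK[dy e]; exists (of_sphere y).
- apply: continuous_in_subspaceT => p; rewrite inE => dp.
  apply: continuous_comp; first exact: reflect_continuous.
  exact/normalize_continuous/to_axis_neq0.
- exists of_sphere; last by move=> p; rewrite inE => /to_sphereK.
  apply: continuous_in_subspaceT => y; rewrite inE.
  move=> /(hilbert_domainE _ c1)[_ yy].
  have idy : z @[z --> y] --> y by exact: cvg_id.
  have ay : to_axis z @[z --> y] --> to_axis y by exact: reflect_continuous.
  exact: (cvgZ (invsqrt_cvg yy (cform_cvg (c := c) idy idy)) ay).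
Qed.

Lemma to_sphere_hilbert_value p q a1 a2 : deSitter p -> deSitter q ->
  hilbert_chord pair (to_sphere p) (to_sphere q) a1 a2 ->
  let d := 2^-1 * ln
    ((sin (sdist (to_sphere p) a2) * sin (sdist (to_sphere q) a1)) /
     (sin (sdist (to_sphere q) a2) * sin (sdist (to_sphere p) a1))) in
  [/\ 0 < d, cosh d = lorentz p q & p 0 ord0 < q 0 ord0].
Proof.
move=> dp dq ch.
have rp : 0 < (Num.sqrt (edot (to_axis p) (to_axis p)))^-1.
  by rewrite invr_gt0 sqrt_edot_gt0// to_axis_neq0.
have rq : 0 < (Num.sqrt (edot (to_axis q) (to_axis q)))^-1.
  by rewrite invr_gt0 sqrt_edot_gt0// to_axis_neq0.
have := chord_distance c1 ch erefl erefl rp rq.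
by rewrite !cform_to_axis !edot_to_axis ltrN2; apply.
Qed.

Lemma to_sphere_hilbert_lt p q : deSitter p -> deSitter q ->
  hilbert_lt pair (to_sphere p) (to_sphere q) <->
    1 < lorentz p q /\ p 0 ord0 < q 0 ord0.
Proof.
move=> dp dq; split=> [[a1 [a2 /(to_sphere_hilbert_value dp dq)[d0 <- ?]]]|[h lt]].
  by split=> //; exact: cosh_gt1.
have [d d0 dE] := cosh_surj h.
apply: (@hilbert_lt_normalize _ _ _ _ _ (expR d)) => //.
- by rewrite expR_gt1.
- by rewrite cform_to_axis.
- by rewrite cform_to_axis.
- by rewrite cform_to_axis -expRN -/(cosh d).
- by rewrite !edot_to_axis ltrN2.
Qed.

End HilbertModel.

(** * Agreement of the orders and of the distances *)

Theorem mainTheorem7 (R : realType) (n : nat) (c : 'rV[R]_n.+1)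
    (hc : usphere c) :
  exists f : 'rV[R]_n.+1 -> 'rV[R]_n.+1,
    homeomorphism_on (@deSitter R n)
      (hilbert_domain (antipodal_pair c (pi / 4))) f /\
    forall p q, deSitter p -> deSitter q ->
      (in_future p q <-> hilbert_lt (antipodal_pair c (pi / 4)) (f p) (f q)) /\
      (p = q \/ in_future p q ->
        exists d : R, deSitter_dist p q = [set d] /\
          hilbert_dist (antipodal_pair c (pi / 4)) (f p) (f q) = [set d]).
Proof.
exists (to_sphere c); split; first exact: to_sphere_homeomorphism.
move=> p q dp dq.
have ltE := iff_trans (in_futureP dp dq) (iff_sym (to_sphere_hilbert_lt hc dp dq)).
split=> // pq.
(* The common distance is the nonnegative [d] with cosh d = <p, q>; [d] = 0 covers equal points. *)
have [d d0 dE] : exists2 d, 0 <= d & cosh d = lorentz p q.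
  case: pq => [<-|/(in_futureP dp dq)[/cosh_surj[d d0 dE] _]].
    by exists 0 => //; rewrite cosh0.
  by exists d => //; exact: ltW.
(* Every geodesic length and every chord value has this same hyperbolic cosine, so injectivity of
   [cosh] on nonnegative reals gives uniqueness; existence comes from [null_geodesic] and from the
   equivalence of orders. *)
have geod a b sigma v : timelike_geodesic a b sigma v -> sigma a = p ->
    sigma b = q -> lorentz_length a b v = d.
  move=> /geodesic_cosh[l0 lE] sa sb; apply: cosh_inj_ge0 => //; first exact: ltW.
  by rewrite lE sa sb.
have chord a1 a2 : hilbert_chord (antipodal_pair c (pi / 4)) (to_sphere c p)
      (to_sphere c q) a1 a2 ->
    2^-1 * ln
    ((sin (sdist (to_sphere c p) a2) * sin (sdist (to_sphere c q) a1)) /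
     (sin (sdist (to_sphere c q) a2) * sin (sdist (to_sphere c p) a1))) = d.
  move=> /(to_sphere_hilbert_value hc dp dq)[l0 lE _].
  by apply: cosh_inj_ge0 => //; [exact: ltW|rewrite lE].
have diag : p = q -> d = 0.
  by move=> e; apply: cosh_inj_ge0; rewrite ?dE -?e ?cosh0.
exists d; split; apply/seteqP; split=> x /=.
- move=> [[/diag -> ->]//|[a [b [sigma [v [geo sa sb ->]]]]]].
  exact: geod geo sa sb.
- move=> ->; case: pq => [e|fut]; first by left; split=> //; exact: diag.
  have [h lt] := (in_futureP dp dq).1 fut.
  have [t t0 tE] := cosh_surj h.
  have E1 : 1 < expR t by rewrite expR_gt1.
  have pqE : lorentz p q = (expR t + (expR t)^-1) / 2 by rewrite -expRN -/(cosh t).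
  have [sigma [v [geo sa sb]]] := null_geodesic E1 dp dq pqE lt.
  right; exists 0, (ln (expR t)), sigma, v; split=> //.
  by rewrite (geod _ _ _ _ geo sa sb).
- move=> [[e ->]|[a1 [a2 [ch ->]]]]; last exact: chord.
  (* Equal images force p = q, because [of_sphere] inverts the projection. *)
  by rewrite diag// -(to_sphereK hc dp) e to_sphereK.
- move=> ->; case: pq => [e|fut]; first by left; rewrite e diag.
  right; have [a1 [a2 ch]] := ltE.1 fut.
  by exists a1, a2; split=> //; rewrite (chord _ _ ch).
Qed.
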